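(* Let $\mathcal{S}$ be a sparse set of positive integers. Then there are uncountably many numbers $x\in\mathcal{C}(\mathcal{S})$ such that $x$ is normal in base $b$ for every odd base $b$.
   Context: $\log$ is the natural logarithm. For a set $\mathcal{S}$ of positive integers and integers $a,c$, $S(a,c)=\#(\mathcal{S}\cap[a,c])$, where $[a,c]$ is the set of integers between $a$ and $c$ inclusive. The set $\mathcal{S}$ is called sparse if it has (asymptotic) density zero and there exists a real number $\rho>0$ (called a sparsity exponent) such that $$\liminf_{k\to\infty}\ \min_{0\le a\le k^{\rho}}\frac{S(a,a+k)}{30\log k}>1,$$ where $k$ and $a$ range over integers. The sparse Cantor set is $\mathcal{C}(\mathcal{S})=\{x\in[0,1): x=\sum_{k\in\mathcal{S}} b_k2^{-k},\ b_k\in\{0,1\}\}$. A base is an integer $\ge 2$. The base-$b$ expansion of a real $x$ is the digit sequence $b_1(x),b_2(x),\dots\in\{0,\dots,b-1\}$ with $x=\lfloor x\rfloor+\sum_{j\ge1}b_j(x)b^{-j}$ that does not end with a tail of digits $b-1$. A real number $x$ is simply normal in base $b$ if each digit $0,\dots,b-1$ occurs with asymptotic frequency $1/b$ in its base-$b$ expansion, and normal in base $b$ if it is simply normal in base $b^k$ for every $k\ge1$. *)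

(* Defs.v *)
From mathcomp Require Import all_boot all_order all_algebra.
From mathcomp Require Import all_classical all_reals all_analysis.

Set Implicit Arguments.
Unset Strict Implicit.
Unset Printing Implicit Defensive.

Import Order.TTheory GRing.Theory Num.Theory.
Import numFieldNormedType.Exports.

Local Open Scope classical_set_scope.
Local Open Scope ring_scope.

(* S(a, c) = #(S `&` [a, c]). *)
Definition count_in (S : set nat) (a c : nat) : nat :=
  count (fun n => n \in S) (index_iota a c.+1).

Definition density_zero (R : realType) (S : set nat) : Prop :=
  (fun n : nat => (count_in S 1 n)%:R / n%:R : R) @ \oo --> (0 : R).

(* The integers 0 <= a <= k^rho are those with 0 <= a <= floor (k^rho).  The
   index set of the minimum always contains a = 0, so the neutral element +oo
   plays no role; the terms k = 0, 1, where ln k = 0, do not affect the liminf. *)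
Definition min_ratio (R : realType) (S : set nat) (rho : R) (k : nat) : \bar R :=
  \big[Order.min/+oo%E]_(0 <= a < (Num.truncn (k%:R `^ rho)).+1)
     ((count_in S a (a + k))%:R / (30 * ln k%:R))%:E.

Definition sparsity_exponent (R : realType) (S : set nat) (rho : R) : Prop :=
  0 < rho /\ (1 < limn_einf (min_ratio S rho))%E.

Definition sparse (R : realType) (S : set nat) : Prop :=
  density_zero R S /\ exists rho : R, sparsity_exponent S rho.

Definition sparse_cantor (R : realType) (S : set nat) : set R :=
  [set x : R | 0 <= x < 1 /\
     exists b : nat -> bool,
       series (fun k : nat => \1_S k * (b k)%:R * 2 ^- k : R) @ \oo --> x].

(* Digits are indexed from 0: [d j] is the coefficient of b^-(j+1). *)
Definition is_expansion (R : realType) (b : nat) (x : R) (d : nat -> nat) : Prop :=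
  [/\ forall j, (d j < b)%N,
      series (fun j : nat => (d j)%:R * b%:R ^- j.+1 : R) @ \oo
        --> x - (Num.floor x)%:~R &
      ~ exists N : nat, forall j, (N <= j)%N -> d j = b.-1].

Definition has_frequency (R : realType) (d : nat -> nat) (c : nat) (f : R) : Prop :=
  (fun n : nat => (count (fun j => d j == c) (iota 0 n))%:R / n%:R : R) @ \oo --> f.

(* The expansion exists and is unique for every b >= 2. *)
Definition simply_normal (R : realType) (b : nat) (x : R) : Prop :=
  exists2 d : nat -> nat, is_expansion b x d &
    forall c, (c < b)%N -> has_frequency d c (b%:R^-1 : R).

Definition normal_in_base (R : realType) (b : nat) (x : R) : Prop :=
  forall k, (0 < k)%N -> simply_normal (b ^ k) x.

(* Main.v *)
Require Import Defs.
From mathcomp Require Import all_boot all_order all_algebra.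
From mathcomp Require Import all_classical all_reals all_analysis.
From mathcomp Require Import ring lra zify.

Import Order.TTheory GRing.Theory Num.Theory.
Import numFieldNormedType.Exports.

Local Open Scope classical_set_scope.
Local Open Scope ring_scope.

(** A point of the Cantor set is given by bits [w], only those at the positions
    in [S] being used; let them be independent fair coin tosses. By Weyl's
    criterion it suffices that, for every odd [b > 1] and every [h > 0], the
    exponential sums of [h * b ^ n * x] over [n < N] are [o(N)].

    The mean of their squared moduli is a double sum of Fourier coefficients of
    the law of [x] at the frequencies [h * b ^ n * (b ^ d - 1)], and the
    coefficient at [y] is, up to a phase, the product of the cosines of
    [pi * y / 2 ^ k] over the [k] in [S] ([avg_cos]). Only here is it used that [b] is odd: once the power
    [2 ^ v] dividing [h * (b ^ d - 1)] is removed, the residues of the odd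
    numbers [u * b ^ n] modulo powers of 2 are so well distributed that each [k]
    of [S] in the window following [v] saves a factor 3/4 on average over [n]
    ([sum_window_le], [sum_frequencies_le]). For [N] of size [2 ^ k] the window
    has length about [k], and it starts below [k ^ rho] for all but a proportion
    [k ^ -4] of the [d], because [v] exceeds the valuation of [d] by a bounded
    quantity ([logn2_expB1]). Sparsity provides [30 * ln k] elements of [S] in
    this window, so that the mean of the squared modulus is
    [O(N ^ 2 * k ^ -4)] ([avg_energy_le], [sparse_decay]).

    This is summable over the lengths [m * 2 ^ k.+2] with [m < 2 * k.+1], which
    are dense enough to control all [N] ([scale_exists]). A Borel--Cantelli
    argument then gives suitable bits. It needs no measure on the space of all
    bit sequences: averages over finitely many bits and Koenig's lemma suffice
    ([borel_cantelli]). The same argument makes the bits differ, at some position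
    in [S], from each sequence in a given countable family; since [S] omits
    infinitely many positions binary expansions supported on [S] are unique, and
    therefore no countable set exhausts the points obtained.

    Weyl's criterion itself is proved by majorising the indicator functions of
    the arcs [c / b <= x < (c + 1) / b] by sampled Fejer kernels
    ([cell_le_fejer]). Upper bounds for the frequencies are enough, because the
    frequencies of all digits add up to 1 ([frequency_of_upper]). *)

(** * Averages over coin tosses and the first moment method *)

Section CoinTossing.
Context {R : realType}.
Implicit Types (f g : (nat -> bool) -> R) (w : nat -> bool).

Definition set_bit w n b : nat -> bool := fun k => if k == n then b else w k.

(** The expectation of [f] when the bits below [n] are independent and fair, and
    all others are [false]. *)
Fixpoint avg n f : R :=
  if n is n'.+1 then
    (avg n' (fun w => f (set_bit w n' true)) +
     avg n' (fun w => f (set_bit w n' false))) / 2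
  else f (fun=> false).

Definition depends_on_first n f :=
  forall w w', (forall k, (k < n)%N -> w k = w' k) -> f w = f w'.

Lemma eq_avg n f g : f =1 g -> avg n f = avg n g.
Proof. by move=> /funext ->. Qed.

Lemma avg0 n : avg n (fun=> 0) = 0.
Proof. by elim: n => //= n ->; rewrite addr0 mul0r. Qed.

Lemma avgD n f g : avg n (fun w => f w + g w) = avg n f + avg n g.
Proof.
elim: n f g => //= n IH f g.
by rewrite !IH; lra.
Qed.

Lemma avgZ n c f : avg n (fun w => c * f w) = c * avg n f.
Proof. by elim: n f => //= n IH f; rewrite !IH mulrA mulrDr. Qed.

Lemma avg_sum n (I : Type) (r : seq I) (P : pred I) (F : I -> (nat -> bool) -> R) :
  avg n (fun w => \sum_(i <- r | P i) F i w) = \sum_(i <- r | P i) avg n (F i).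
Proof.
elim: r => [|i r IH].
  by rewrite big_nil -[RHS](avg0 n); apply: eq_avg => w; rewrite big_nil.
rewrite big_cons -IH; case: ifP => Pi.
  by rewrite -avgD; apply: eq_avg => w; rewrite big_cons Pi.
by apply: eq_avg => w; rewrite big_cons Pi.
Qed.

Lemma le_avg n f g : (forall w, f w <= g w) -> avg n f <= avg n g.
Proof.
elim: n f g => //= n IH f g fg.
by rewrite ler_pM2r ?invr_gt0// lerD// IH.
Qed.

Lemma exists_le_avg n f : exists w, f w <= avg n f.
Proof.
elim: n f => [|n IH] f /=; first by exists (fun=> false).
have [w1 h1] := IH (fun w => f (set_bit w n true)).
have [w2 h2] := IH (fun w => f (set_bit w n false)).
have [h|h] := leP (f (set_bit w1 n true)) (f (set_bit w2 n false)).
  by exists (set_bit w1 n true); lra.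
by exists (set_bit w2 n false); lra.
Qed.

Lemma avg_widen m n f : (m <= n)%N -> depends_on_first m f -> avg n f = avg m f.
Proof.
move=> + df; elim: n => [|n IH]; first by rewrite leqn0 => /eqP ->.
rewrite leq_eqVlt => /predU1P[-> //|]; rewrite ltnS => mn /=.
have bit b : avg n (fun w => f (set_bit w n b)) = avg m f.
  rewrite -(IH mn); apply: eq_avg => w; apply: df => k km.
  by rewrite /set_bit ltn_eqF// (leq_trans km).
by rewrite !bit; lra.
Qed.

Lemma avg_prod n (g : nat -> bool -> R) :
  avg n (fun w => \prod_(k < n) g k (w k)) =
  \prod_(k < n) ((g k true + g k false) / 2).
Proof.
elim: n => [|n IH] /=; first by rewrite !big_ord0.
have bit b : avg n (fun w => \prod_(k < n.+1) g k (set_bit w n b k)) =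
    g n b * avg n (fun w => \prod_(k < n) g k (w k)).
  rewrite -avgZ; apply: eq_avg => w.
  rewrite big_ord_recr /= {2}/set_bit eqxx mulrC; congr (_ * _).
  by apply: eq_bigr => k _; rewrite /set_bit ltn_eqF.
by rewrite !bit IH big_ord_recr /= -mulrDl mulrAC mulrC.
Qed.

(** The real form of the factorisation of the Fourier transform of an
    independent sum: flipping one bit replaces [cos x] by [cos (x + a)], and
    the mean of these two is [cos (a / 2) * cos (x + a / 2)]. *)
Lemma avg_cos n (a : nat -> R) (x : R) :
  avg n (fun w => cos (x + \sum_(k < n) (w k)%:R * a k)) =
  cos (x + \sum_(k < n) a k / 2) * \prod_(k < n) cos (a k / 2).
Proof.
elim: n x => [|n IH] x /=; first by rewrite !big_ord0 addr0 mulr1.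
have bit b : avg n (fun w => cos (x + \sum_(k < n.+1) (set_bit w n b k)%:R * a k)) =
    avg n (fun w => cos (x + b%:R * a n + \sum_(k < n) (w k)%:R * a k)).
  apply: eq_avg => w; congr cos.
  rewrite big_ord_recr /= {2}/set_bit eqxx -addrA [in RHS](addrC _ (\sum_(_ < _) _)).
  congr (_ + (_ + _)).
  by apply: eq_bigr => k _; rewrite /set_bit ltn_eqF.
rewrite !bit !IH mul1r mul0r addr0 !big_ord_recr /=.
set s := \sum_(_ < n) _; set p := \prod_(_ < n) _.
have -> : x + a n + s = (x + s + a n / 2) + a n / 2 by lra.
have -> : x + (s + a n / 2) = x + s + a n / 2 by lra.
have -> : x + s = (x + s + a n / 2) - a n / 2 by lra.
by rewrite subrK cosD cosB; field.
Qed.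

Lemma avg_cos_le n (a : nat -> R) (x : R) :
  avg n (fun w => cos (x + \sum_(k < n) (w k)%:R * a k)) <=
  \prod_(k < n) `|cos (a k / 2)|.
Proof.
rewrite avg_cos; apply: le_trans (ler_norm _) _.
by rewrite normrM normr_prod ler_piMl ?cos_max// prodr_ge0.
Qed.

End CoinTossing.

Section Selection.
Context {R : realType}.
Implicit Types w : nat -> bool.

(** Koenig's lemma: the prefixes that extend, for every [n], to some point
    satisfying [Q n] form an infinite binary tree. *)
Lemma koenig (Q : nat -> (nat -> bool) -> Prop) (L : nat -> nat) :
  (forall n w w', (forall k, (k < L n)%N -> w k = w' k) -> Q n w -> Q n w') ->
  (forall n w, Q n.+1 w -> Q n w) -> (forall n, exists w, Q n w) ->
  exists w, forall n, Q n w.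
Proof.
move=> Qdep Qmon Qex.
have Qle m n w : (m <= n)%N -> Q n w -> Q m w.
  elim: n => [|n IH]; first by rewrite leqn0 => /eqP ->.
  by rewrite leq_eqVlt => /predU1P[-> //|]; rewrite ltnS => mn /Qmon; exact: IH.
pose ext (s : seq bool) := forall n, exists2 w, Q n w & mkseq w (size s) = s.
have ext0 : ext [::] by move=> n; have [w Qw] := Qex n; exists w.
have extS s : ext s -> exists b, ext (rcons s b).
  move=> es; apply: contrapT => nb.
  have {}nb b : exists n, forall w, Q n w -> mkseq w (size s).+1 <> rcons s b.
    apply: contrapT => nn; apply: nb; exists b => n.
    apply: contrapT => nw; apply: nn; exists n => w Qw e.
    by apply: nw; exists w => //; rewrite size_rcons.
  have [n1 h1] := nb true; have [n2 h2] := nb false.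
  have [w Qw ws] := es (maxn n1 n2).
  have := mkseqS w (size s); rewrite ws.
  case: (w (size s)) => e.
    by apply: (h1 w) e; apply: Qle Qw; exact: leq_maxl.
  by apply: (h2 w) e; apply: Qle Qw; exact: leq_maxr.
have [F hF] : {F : seq bool -> bool & forall s, ext s -> ext (rcons s (F s))}.
  by apply: (@choice _ _ (fun s b => ext s -> ext (rcons s b))) => s;
    have [/extS[b]|?] := pselect (ext s); [exists b | exists true].
pose pre := fix pre n := if n is n'.+1 then rcons (pre n') (F (pre n')) else [::].
have ext_pre n : ext (pre n) by elim: n => //= n; exact: hF.
have size_pre n : size (pre n) = n by elim: n => //= n; rewrite size_rcons => ->.
pose w n := F (pre n).
have preE n : pre n = mkseq w n by elim: n => //= n IH; rewrite mkseqS -IH.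
exists w => n; have [w' Qw'] := ext_pre (L n) n; rewrite size_pre preE => e.
apply: Qdep Qw' => k kL.
by rewrite -(nth_mkseq true w' kL) e nth_mkseq.
Qed.

Lemma sum_inv_sqr_le n : \sum_(i < n) (i.+1%:R ^- 2 : R) <= 2.
Proof.
case: n => [|n]; first by rewrite big_ord0.
suff: \sum_(i < n.+1) (i.+1%:R ^- 2 : R) <= 2 - n.+1%:R^-1.
  by move=> h; apply: le_trans h _; rewrite lerBlDr lerDl invr_ge0.
elim: n => [|n IH]; first by rewrite big_ord1 expr1n invr1; lra.
rewrite big_ord_recr /=.
have n0 : (0 : R) < n.+1%:R by [].
rewrite -(natr1 n.+1); set x : R := n.+1%:R in IH n0 *.
suff h : (x + 1) ^- 2 <= x^-1 - (x + 1)^-1.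
  by apply: le_trans (lerD IH h) _; rewrite addrA subrK.
have -> : x^-1 - (x + 1)^-1 = (x * (x + 1))^-1.
  by field; rewrite !gt_eqF//; lra.
by rewrite lef_pV2 ?posrE ?mulr_gt0 ?exprn_gt0//; nra.
Qed.

End Selection.

Section BorelCantelli.
Context {R : realType}.
Implicit Types w : nat -> bool.

(** The averages being summable, the weighted sums [Phi n] of all the functions
    stay bounded on average, hence for each [n] at some point; Koenig's lemma
    provides one point for all [n], and the terms of a convergent series tend to
    zero. Each [F p] may start late, which is why it enters [G i] only for
    [I p <= i]. *)
Lemma borel_cantelli (F : nat -> nat -> (nat -> bool) -> R) (L : nat -> nat -> nat) :
  (forall p i w, 0 <= F p i w) ->
  (forall p i, depends_on_first (L p i) (F p i)) ->
  (forall p, \forall i \near \oo, avg (L p i) (F p i) <= i.+1%:R ^- 2) ->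
  exists w, forall p, F p i w @[i --> \oo] --> 0.
Proof.
move=> F0 Fdep Favg.
have [I hI] : {I : nat -> nat & forall p i, (I p <= i)%N ->
    avg (L p i) (F p i) <= i.+1%:R ^- 2}.
  apply: (@choice _ _ (fun p I => forall i, (I <= i)%N -> avg (L p i) (F p i) <= _)) => p.
  by have [N _ hN] := Favg p; exists N => i Ni; exact: hN.
(* The weights [2 ^- p] have sum at most 2, as have the averages [i.+1 ^- 2]:
   hence the bound 4 below. *)
pose G i w : R := \sum_(p < i.+1 | (I p <= i)%N) 2^-1 ^+ p * F p i w.
pose Phi n w : R := \sum_(i < n) G i w.
have G0 i w : 0 <= G i w.
  by apply: sumr_ge0 => p _; rewrite mulr_ge0// exprn_ge0.
pose M i := \max_(p < i.+1) L p i.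
have LM i (p : 'I_i.+1) : (L p i <= M i)%N by exact: (leq_bigmax p).
have Gdep i : depends_on_first (M i) (G i).
  move=> w w' e; apply: eq_bigr => p _; congr (_ * _); apply: Fdep => k kL.
  by apply: e; exact: leq_trans (LM i p).
pose K n := \max_(i < n) M i.
have MK n (i : 'I_n) : (M i <= K n)%N by exact: (leq_bigmax i).
have Gavg i n : (M i <= n)%N -> avg n (G i) <= 2 * i.+1%:R ^- 2.
  move=> Mn; rewrite (avg_widen _ _ _ Mn (Gdep i)) avg_sum.
  apply: (@le_trans _ _ (\sum_(p < i.+1 | (I p <= i)%N) 2^-1 ^+ p * i.+1%:R ^- 2)).
    apply: ler_sum => p Ip; rewrite avgZ ler_wpM2l ?exprn_ge0//.
    by rewrite (avg_widen _ _ _ (LM i p) (Fdep p i)) hI.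
  rewrite -mulr_suml ler_wpM2r ?invr_ge0 ?exprn_ge0//.
  apply: (@le_trans _ _ (\sum_(p < i.+1) (2^-1 : R) ^+ p)).
    by rewrite [leRHS](bigID (fun p : 'I_i.+1 => (I p <= i)%N)) /= lerDl sumr_ge0// => p _;
      rewrite exprn_ge0.
  have h : (1 - 2^-1) * (\sum_(p < i.+1) (2^-1 : R) ^+ p) = 1 - 2^-1 ^+ i.+1.
    by have := subrX1 (2^-1 : R) i.+1; lra.
  have h2 : 0 <= (2^-1 : R) ^+ i.+1 by rewrite exprn_ge0.
  by move: h; lra.
have [w hw] : exists w, forall n, Phi n w <= 4.
  apply: (@koenig (fun n w => Phi n w <= 4) K) => [n w w' e|n w|n].
  - suff -> : Phi n w = Phi n w' by [].
    apply: eq_bigr => i _; apply: Gdep => k kL.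
    by apply: e; exact: leq_trans (MK n i).
  - by apply: le_trans; rewrite /Phi big_ord_recr /= lerDl.
  - have [w hw] := exists_le_avg (K n) (Phi n); exists w.
    apply: le_trans hw _; rewrite /Phi avg_sum.
    apply: (@le_trans _ _ (\sum_(i < n) 2 * (i.+1%:R ^- 2))).
      by apply: ler_sum => i _; exact/Gavg/MK.
    by rewrite -mulr_sumr; have := @sum_inv_sqr_le R n; lra.
have Gw : G^~ w @ \oo --> 0.
  apply: cvg_series_cvg_0.
  apply: nondecreasing_is_cvgn.
    by apply: nondecreasing_series => i _ _.
  exists 4 => _ [n _ <-].
  by rewrite /= seriesEord; exact: hw.
exists w => p.
apply: (@squeeze_cvgr _ _ _ _ (fun=> 0) (fun i => 2 ^+ p * G i w)).
- near=> i; rewrite F0 /=.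
  have pi : (p < i.+1)%N by rewrite ltnS; near: i; exact: nbhs_infty_ge.
  have Ip : (I p <= i)%N by near: i; exact: nbhs_infty_ge.
  rewrite /G (bigD1 (Ordinal pi)) //= mulrDr mulrA -exprMn divff// expr1n mul1r.
  rewrite lerDl mulr_ge0 ?exprn_ge0// sumr_ge0// => q _.
  by rewrite mulr_ge0// exprn_ge0.
- exact: cvg_cst.
- by rewrite -(mulr0 (2 ^+ p)); exact: cvgMr.
Unshelve. all: by end_near.
Qed.

End BorelCantelli.

(** * Products of cosines along a geometric progression *)

Section Dyadic.
Local Open Scope nat_scope.

(** Modulo [2 ^ r.+1] the powers of [1 + 2 ^ r * o] depend only on the parity of
    the exponent. *)
Lemma odd_expansionX r o e : (0 < r)%N -> odd o ->
  exists2 z, ((1 + 2 ^ r * o) ^ e = 1 + 2 ^ r * z)%N & odd z = odd e.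
Proof.
case: r => // r _ oo; elim: e => [|e [z ze oz]].
  by exists 0%N; rewrite ?muln0.
exists (z + o + 2 ^ r.+1 * (z * o))%N; last first.
  by rewrite !oddD oz oo expnS -mulnA mul2n odd_double addbF addbT.
by rewrite expnSr ze; ring.
Qed.

Lemma odd_expansionX2 r o i : (1 < r)%N -> odd o ->
  exists2 z, ((1 + 2 ^ r * o) ^ 2 ^ i = 1 + 2 ^ (r + i) * z)%N & odd z.
Proof.
move=> r1 oo; elim: i => [|i [z ze oz]]; first by exists o; rewrite ?addn0 ?expn1.
exists (z + 2 ^ (r + i).-1 * z ^ 2)%N.
  rewrite expnSr expnM ze addnS.
  have -> : (r + i = (r + i).-1.+1)%N by rewrite prednK// addn_gt0 ltnW.
  by rewrite !expnS /=; ring.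
have -> : ((r + i).-1 = (r + i).-2.+1)%N by lia.
by rewrite oddD oz expnS -mulnA mul2n odd_double.
Qed.

Lemma sqr_odd_expansion b : (1 < b)%N -> odd b ->
  exists s o, [/\ (1 < s)%N, odd o & (b ^ 2 = 1 + 2 ^ s * o)%N].
Proof.
move=> b1 ob; set q := (b ^ 2).-1.
have q0 : (0 < q)%N by rewrite /q; nia.
have d4 : (4 %| q)%N.
  rewrite /q -(odd_double_half b) ob -mul2n; set h := (b./2).
  have -> : ((true + 2 * h) ^ 2).-1 = 4 * (h + h ^ 2).
    by rewrite /=; nia.
  exact: dvdn_mulr.
have [u ou qe] := pfactor_coprime (isT : prime 2) q0.
exists (logn 2 q), u; split; rewrite -?coprime2n//.
  by rewrite -(pfactor_dvdn 2).
by rewrite mulnC -qe /q add1n prednK // expn_gt0 ltnW.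
Qed.

(** Lifting the exponent at 2: [b ^ 2 - 1] being [2 ^ s] times an odd number,
    [b ^ d - 1] divides [(b ^ 2) ^ d - 1], of 2-adic valuation [s + logn 2 d]. *)
Lemma logn2_expB1 b s o d : (1 < b)%N -> (1 < s)%N -> odd o ->
  (b ^ 2 = 1 + 2 ^ s * o)%N -> (0 < d)%N ->
  (logn 2 (b ^ d).-1 <= s + logn 2 d)%N.
Proof.
move=> b1 s1 oo be d0.
have bd : (1 < b ^ d)%N by rewrite -(exp1n d) ltn_exp2r.
have [e oe de] := pfactor_coprime (isT : prime 2) d0.
have [z ze oz] := odd_expansionX2 s o (logn 2 d) s1 oo.
have [y ye oy] := odd_expansionX (s + logn 2 d) z e (ltn_addr _ (ltnW s1)) oz.
have E : ((b ^ d) ^ 2 = 1 + 2 ^ (s + logn 2 d) * y)%N.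
  by rewrite expnAC be [in LHS]de (mulnC e) expnM ze ye.
have y0 : odd y by rewrite oy -coprime2n.
have F : ((b ^ d).-1 * (b ^ d).+1 = 2 ^ (s + logn 2 d) * y)%N.
  move: E bd; case: (b ^ d)%N => // n; nia.
have : (logn 2 ((b ^ d).-1 * (b ^ d).+1) = s + logn 2 d)%N.
  rewrite F lognM ?expn_gt0 ?(odd_gt0 y0)// pfactorK// (lognE 2 y).
  by rewrite dvdn2 y0 /= andbF addn0.
have b0 : 0 < (b ^ d).-1 by rewrite -subn1 subn_gt0.
by rewrite lognM// => <-; exact: leq_addr.
Qed.

End Dyadic.

Section WindowSum.
Context {R : realType}.

Lemma norm_cosD_natpi (x : R) n : `|cos (x + n%:R * pi)| = `|cos x|.
Proof.
elim: n => [|n IH]; first by rewrite mul0r addr0.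
by rewrite -natr1 mulrDl mul1r addrA cosDpi normrN.
Qed.

Lemma norm_sinD_natpi (x : R) n : `|sin (x + n%:R * pi)| = `|sin x|.
Proof.
elim: n => [|n IH]; first by rewrite mul0r addr0.
by rewrite -natr1 mulrDl mul1r addrA sinDpi normrN.
Qed.

Lemma norm_cosD_oddpi2 (x : R) n : odd n ->
  `|cos (x + n%:R * (pi / 2))| = `|sin x|.
Proof.
move=> on; rewrite -(odd_double_half n) on -mul2n natrD natrM.
have -> : x + (1 + 2 * n./2%:R) * (pi / 2) = (x + n./2%:R * pi) + pi / 2.
  by set m := n./2%:R; field.
by rewrite cosDpihalf normrN norm_sinD_natpi.
Qed.

Lemma norm_cosDsin_le (x : R) : `|cos x| + `|sin x| <= 3 / 2.
Proof.
have := cos2Dsin2 x.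
rewrite -(real_normK (num_real (cos x))) -(real_normK (num_real (sin x))).
set c := `|cos x|; set s := `|sin x| => cs.
by rewrite leNgt; apply/negP => h; have := sqr_ge0 (c - s); nra.
Qed.

(** The angle [pi * y / 2 ^ k] determines the size of the [k]-th factor of the
    Fourier transform at the frequency [y]. *)
Definition ncos (y k : nat) : R := `|cos (y%:R * pi / 2 ^+ k)|.

Lemma ncos_le1 y k : ncos y k <= 1. Proof. exact: cos_max. Qed.

Lemma ncos_shift v y k : ncos (2 ^ v * y) (v + k) = ncos y k.
Proof.
rewrite /ncos natrM natrX exprD; congr `|cos _|.
by field; rewrite !expf_neq0.
Qed.

Lemma ncosD_mul y z k : ncos (y + 2 ^ k * z) k = ncos y k.
Proof.
rewrite /ncos -[RHS](norm_cosD_natpi _ z) natrD natrM natrX; congr `|cos _|.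
by field; rewrite expf_neq0.
Qed.

Lemma ncosD_half y z k : odd z ->
  ncos y k.+1 + ncos (y + 2 ^ k * z) k.+1 <= 3 / 2.
Proof.
move=> oz; rewrite {2}/ncos natrD natrM natrX.
have -> : (y%:R + 2 ^+ k * z%:R) * pi / 2 ^+ k.+1 =
    y%:R * pi / 2 ^+ k.+1 + z%:R * (pi / 2) :> R.
  by rewrite exprS; field; rewrite expf_neq0.
by rewrite norm_cosD_oddpi2// norm_cosDsin_le.
Qed.

(** Passing from [i] to [i.+1] doubles the range of [n], and [c ^ 2 ^ i] equals 1
    modulo [2 ^ (s + i)] but not modulo [2 ^ (s + i).+1]: the second half of the range
    repeats the old factors of the first half, and adds a half-turn to the angle of the
    new factor, whose two values [`|cos x|] and [`|sin x|] have mean at most 3/4. *)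
Lemma sum_window_le (s o c w i : nat) (P : pred nat) :
  (1 < s)%N -> odd o -> c = (1 + 2 ^ s * o)%N -> odd w ->
  \sum_(n < 2 ^ i) \prod_(j < i | P j) ncos (w * c ^ n) (s + j).+1 <=
  2 ^+ i * \prod_(j < i | P j) (3 / 4).
Proof.
move=> s1 oo ce ow; elim: i => [|i IH].
  by rewrite big_ord1 !big_ord0 mulr1.
have oc : odd c by rewrite ce oddD oddM oddX orbF eqn0Ngt (ltnW s1).
have [z ze oz] := odd_expansionX2 s o i s1 oo.
pose g n : R := \prod_(j < i | P j) ncos (w * c ^ n) (s + j).+1.
pose h n : R := if P i then ncos (w * c ^ n) (s + i).+1 else 1.
have gh n : \prod_(j < i.+1 | P j) ncos (w * c ^ n) (s + j).+1 = g n * h n.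
  by rewrite big_mkcond big_ord_recr /= -big_mkcond.
have step n : (w * c ^ (n + 2 ^ i) = w * c ^ n + 2 ^ (s + i) * (w * c ^ n * z))%N.
  by rewrite expnD ce ze; ring.
have gD n : g (n + 2 ^ i)%N = g n.
  apply: eq_bigr => j _; rewrite step.
  have -> : (s + i = (s + j).+1 + (i - j.+1))%N by have := ltn_ord j; lia.
  by rewrite expnD -mulnA ncosD_mul.
have hD n : h n + h (n + 2 ^ i)%N <= 2 * (if P i then 3 / 4 else 1).
  rewrite /h; case: (P i); last by lra.
  rewrite step; have -> : 2 * (3 / 4) = 3 / 2 :> R by lra.
  by apply: ncosD_half; rewrite !oddM ow oddX oc orbT oz.
under eq_bigr do rewrite gh.
rewrite expnS mul2n -addnn big_split_ord /=.
under [X in _ + X]eq_bigr do rewrite addnC gD.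
rewrite -big_split /=.
rewrite [X in _ <= _ * X]big_mkcond big_ord_recr /= -big_mkcond exprSr.
apply: (@le_trans _ _ (\sum_(n < 2 ^ i) g n * (2 * (if P i then 3 / 4 else 1)))).
  apply: ler_sum => n _; rewrite -mulrDr ler_wpM2l//.
  by rewrite /g prodr_ge0// => j _; rewrite normr_ge0.
rewrite -mulr_suml; set t := 2 * _.
have -> : 2 ^+ i * 2 * (\prod_(j < i | P j) (3 / 4) * (if P i then 3 / 4 else 1)) =
   (2 ^+ i * \prod_(j < i | P j) (3 / 4)) * t :> R by rewrite /t; ring.
rewrite ler_wpM2r// /t.
by case: (P i); lra.
Qed.

End WindowSum.

(** * Second moment of exponential sums *)

Section SecondMoment.
Context {R : realType}.
Implicit Types (P : pred nat) (w : nat -> bool).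

Lemma sum_blocks_le (f : nat -> R) (B : R) (m K : nat) :
  (forall c, \sum_(e < K) f (c * K + e)%N <= B) ->
  \sum_(n < m * K) f n <= m%:R * B.
Proof.
move=> fB; elim: m => [|m IH]; first by rewrite big_ord0 mul0r.
rewrite mulSn addnC big_split_ord /= -natr1 mulrDl mul1r lerD//.
Qed.

Lemma sum_double (f : nat -> R) (n : nat) :
  \sum_(k < 2 * n) f k = \sum_(k < n) (f (2 * k)%N + f (2 * k + 1)%N).
Proof.
elim: n => [|n IH]; first by rewrite muln0 !big_ord0.
rewrite [RHS]big_ord_recr /= -IH mulnS addnC !addnS addn0 !big_ord_recr /=.
by rewrite addrA.
Qed.

(** Pairs of indices are reparametrised by the smaller index [n] and the
    difference [d]. *)
Lemma sum_sym_le (f : nat -> nat -> R) (N : nat) :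
  (forall m n, 0 <= f m n) -> (forall m n, f m n = f n m) ->
  \sum_(m < N) \sum_(n < N) f m n <= 2 * \sum_(d < N) \sum_(n < N) f (n + d)%N n.
Proof.
move=> f0 fC; pose U := \sum_(n < N) \sum_(m < N | (n <= m)%N) f m n.
have -> : 2 * \sum_(d < N) \sum_(n < N) f (n + d)%N n =
    2 * \sum_(n < N) \sum_(d < N) f (n + d)%N n by rewrite exchange_big.
apply: (@le_trans _ _ (2 * U)).
  rewrite mulr_natl mulr2n {1}/U [X in _ <= X + _](exchange_big_dep xpredT) //= -big_split /=.
  apply: ler_sum => n _.
  rewrite (bigID (fun m : 'I_N => (m <= n)%N)) /= lerD2l.
  rewrite big_mkcond [X in _ <= X]big_mkcond; apply: ler_sum => m _.
  have [h|h] := leqP m n => /=; last by rewrite (ltnW h) fC.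
  by case: ifP.
rewrite ler_pM2l//; apply: ler_sum => n _.
rewrite -(big_mkord (fun m => (n <= m)%N) (fun m => f m n)).
rewrite -(big_mkord xpredT (fun d => f (n + d)%N n)).
rewrite (big_cat_nat (n := n)) ?(ltnW (ltn_ord n))//= big_nat_cond big1 ?add0r; last first.
  by move=> m /andP[/andP[_ mn] nm]; rewrite ltnNge nm in mn.
rewrite -{1}(add0n (n : nat)) big_addn.
rewrite [X in _ <= X](big_cat_nat (n := (N - n)%N)) ?leq_subr//=.
rewrite -[X in X <= _]addr0 lerD ?sumr_ge0//.
rewrite big_mkcond; apply: ler_sum => d _.
by rewrite addnC; case: ifP => // _; exact: f0.
Qed.

(** The squared modulus of the exponential sum with phases [t n]. *)
Definition energy (t : nat -> R) (N : nat) : R :=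
  (\sum_(n < N) cos (t n)) ^+ 2 + (\sum_(n < N) sin (t n)) ^+ 2.

Lemma energy_ge0 t N : 0 <= energy t N.
Proof. by rewrite addr_ge0 ?sqr_ge0. Qed.

Lemma energyE t N : energy t N = \sum_(m < N) \sum_(n < N) cos (t m - t n).
Proof.
rewrite /energy !expr2 !mulr_suml -big_split /=; apply: eq_bigr => m _.
rewrite !mulr_sumr -big_split /=; apply: eq_bigr => n _.
by rewrite cosB.
Qed.

Lemma cos_natdist (c : R) (m n : nat) :
  cos (m%:R * c - n%:R * c) = cos ((m - n + (n - m))%:R * c).
Proof.
rewrite -mulrBl; have [le|/ltnW le] := leqP n m.
  by rewrite (eqP le) addn0 natrB.
by rewrite (eqP le) add0n natrB// -[RHS]cosN -mulNr opprB.
Qed.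

Definition truncated P L w : R := \sum_(k < L) (w k)%:R * ((P k)%:R / 2 ^+ k).

Lemma avg_cos_truncated_le P L (y : nat) :
  avg L (fun w => cos (2 * pi * y%:R * truncated P L w)) <=
  \prod_(k < L | P k) ncos y k.
Proof.
pose a k : R := 2 * (y%:R * pi * (P k)%:R / 2 ^+ k).
have -> : avg L (fun w => cos (2 * pi * y%:R * truncated P L w)) =
    avg L (fun w => cos (0 + \sum_(k < L) (w k)%:R * a k)).
  apply: eq_avg => w; rewrite add0r /truncated mulr_sumr; congr cos.
  by apply: eq_bigr => k _; rewrite /a; ring.
apply: le_trans (avg_cos_le _ _ _) _.
rewrite [X in _ <= X]big_mkcond; apply: ler_prod => k _.
rewrite normr_ge0 /= /a mulrC mulKf//.
case: (P k); first by rewrite mulr1 /ncos.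
by rewrite mulr0 mul0r cos0 normr1.
Qed.

Lemma prod_shift P (f : nat -> R) (a i : nat) :
  \prod_(a <= k < a + i | P k) f k = \prod_(j < i | P (a + j)%N) f (a + j)%N.
Proof.
have := @big_addn R 1 *%R 0 (a + i) a P f; rewrite add0n addKn big_mkord => ->.
by apply: eq_big => [j|j _]; rewrite addnC.
Qed.

Lemma prod_window_le P (f : nat -> R) (a i L : nat) :
  (forall k, 0 <= f k <= 1) -> (a + i <= L)%N ->
  \prod_(k < L | P k) f k <= \prod_(j < i | P (a + j)%N) f (a + j)%N.
Proof.
move=> f01 aiL.
have pr1 m n : 0 <= \prod_(m <= k < n | P k) f k <= 1.
  rewrite prodr_ge0 => [|k _]; last by have /andP[] := f01 k.
  by apply: prodr_ile1 => k _; exact: f01.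
rewrite -prod_shift.
rewrite -(big_mkord P f) (big_cat_nat (n := (a + i)%N))//=.
rewrite (big_cat_nat (n := a) (p := (a + i)%N))//= ?leq_addr//.
set p := bigop _ _ _; set q := bigop _ _ _; set r := bigop _ _ _.
have /andP[p0 p1] : 0 <= p <= 1 by exact: pr1.
have /andP[q0 q1] : 0 <= q <= 1 by exact: pr1.
have /andP[r0 r1] : 0 <= r <= 1 by exact: pr1.
by apply: (@le_trans _ _ (p * q)); [rewrite ler_piMr// mulr_ge0|rewrite ler_piMl].
Qed.

(** Indices of the same parity in a block of length [2 ^ i.+1] run through a
    progression with ratio [b ^ 2], to which [sum_window_le] applies, the first
    term of the progression being absorbed in the odd number [u * b ^ _]. *)
Lemma sum_frequencies_le P (s o b q i m L : nat) :
  (1 < s)%N -> odd o -> odd b -> (b ^ 2 = 1 + 2 ^ s * o)%N -> (0 < q)%N ->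
  let a := (logn 2 q + s).+1 in (a + i <= L)%N ->
  \sum_(n < m * 2 ^ i.+1) \prod_(k < L | P k) ncos (q * b ^ n) k <=
  (m * 2 ^ i.+1)%:R * (3 / 4 : R) ^+ count P (index_iota a (a + i)).
Proof.
move=> s1 oo ob be q0 a aL.
have [u + qe] := pfactor_coprime (isT : prime 2) q0.
rewrite coprime2n => ou; rewrite mulnC in qe; set v := logn 2 q in qe a aL *.
have prodE : (3 / 4 : R) ^+ count P (index_iota a (a + i)) =
    \prod_(j < i | P (v + (s + j).+1)%N) (3 / 4).
  transitivity (\prod_(a <= k < a + i | P k) (3 / 4 : R)).
    by rewrite big_const_seq iter_mulr_1.
  rewrite prod_shift.
  by apply: eq_bigl => j; congr P; rewrite /a; lia.
rewrite natrM -mulrA; apply: (sum_blocks_le (fun n => \prod_(k < L | P k) ncos (q * b ^ n) k)) => c.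
have -> : (2 ^ i.+1)%:R = 2 * 2 ^+ i :> R by rewrite natrX exprS.
rewrite expnS (sum_double (fun e => \prod_(k < L | P k) ncos (q * b ^ (c * (2 * 2 ^ i) + e)) k)).
rewrite big_split /= -mulrA (mulr_natl _ 2) mulr2n.
have half (e : nat) :
    \sum_(n < 2 ^ i) \prod_(k < L | P k) ncos (q * b ^ (c * (2 * 2 ^ i) + (2 * n + e))) k <=
    2 ^+ i * (3 / 4 : R) ^+ count P (index_iota a (a + i)).
  rewrite prodE.
  have := sum_window_le (R := R) s o (b ^ 2) (u * b ^ (c * (2 * 2 ^ i) + e)) i
    (fun j => P (v + (s + j).+1)%N) s1 oo be.
  rewrite oddM ou oddX ob orbT => /(_ isT); apply: le_trans.
  apply: ler_sum => n _.
  have -> : (q * b ^ (c * (2 * 2 ^ i) + (2 * n + e)) =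
      2 ^ v * (u * b ^ (c * (2 * 2 ^ i) + e) * (b ^ 2) ^ n))%N.
    by rewrite {1}qe (addnC (2 * n)%N) addnA (expnD b _ (2 * n)) -expnM !mulnA.
  apply: le_trans (@prod_window_le P _ a i L _ aL) _ => [k|].
    by rewrite normr_ge0 ncos_le1.
  rewrite le_eqVlt; apply/predU1P; left; apply: eq_big => [j|j _].
    by congr P; rewrite /a; lia.
  by rewrite -[RHS](ncos_shift v); congr ncos; rewrite /a; lia.
apply: lerD; last exact: half 1%N.
by apply: le_trans (half 0%N); apply: ler_sum => n _; rewrite addn0.
Qed.

Lemma sum_multiples_le (K m : nat) : (0 < K)%N ->
  \sum_(d < m * K) (K %| d)%N%:R <= m%:R :> R.
Proof.
move=> K0; rewrite -[leRHS]mulr1.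
apply: (sum_blocks_le (fun d => (K %| d)%N%:R)) => c.
case: K K0 => // K _; rewrite big_ord_recl big1 /=; last first.
  move=> e _; rewrite dvdn_addr ?dvdn_mull// gtnNdvd//.
  by rewrite /bump /= add1n ltnS ltn_ord.
by rewrite addn0 dvdn_mull ?addr0.
Qed.

(** Davenport--Erdős--LeVeque second moment. The differences [d] divisible by [2 ^ J],
    for which the 2-adic valuation of [h * b ^ n * (b ^ d - 1)] is large, are few;
    for all others the window after the valuation gives the saving [q]. *)
Lemma avg_energy_le P (h b s o J m i L : nat) (q : R) :
  (0 < h)%N -> (1 < b)%N -> odd b -> (1 < s)%N -> odd o ->
  (b ^ 2 = 1 + 2 ^ s * o)%N -> (J <= i.+1)%N ->
  (logn 2 h + 2 * s + J + i <= L)%N ->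
  (forall a, (a <= logn 2 h + 2 * s + J)%N ->
     (3 / 4) ^+ count P (index_iota a (a + i)) <= q) ->
  avg L (fun w => energy (fun n => 2 * pi * (h * b ^ n)%:R * truncated P L w)
                         (m * 2 ^ i.+1)) <=
  2 * (m * 2 ^ i.+1)%:R ^+ 2 * (2^-1 ^+ J + q).
Proof.
move=> h0 b1 ob s1 oo be Ji hL hq; set N := (m * 2 ^ i.+1)%N.
pose y n := (h * b ^ n)%N.
pose B z : R := \prod_(k < L | P k) ncos z k.
have B0 z : 0 <= B z by apply: prodr_ge0 => k _; exact: normr_ge0.
have B1 z : B z <= 1 by apply: prodr_ile1 => k _; rewrite normr_ge0 ncos_le1.
pose D m n := (y m - y n + (y n - y m))%N.
have q0 : 0 <= q by apply: le_trans (hq 0%N _); rewrite ?exprn_ge0.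
apply: (@le_trans _ _ (\sum_(m < N) \sum_(n < N) B (D m n))).
  under eq_avg do rewrite energyE.
  rewrite avg_sum; apply: ler_sum => m' _; rewrite avg_sum; apply: ler_sum => n _.
  apply: le_trans (avg_cos_truncated_le _ _ _).
  rewrite le_eqVlt; apply/predU1P; left; apply: eq_avg => w.
  rewrite -/(y m') -/(y n) !(mulrAC _ _ (truncated P L w)) !(mulrC _ _%:R).
  by rewrite cos_natdist.
have DC m' n : D m' n = D n m' by rewrite /D addnC.
apply: le_trans (sum_sym_le (fun m n => B (D m n)) N _ _) _ => //.
  by move=> m' n; rewrite DC.
rewrite -mulrA ler_pM2l//.
have Dd n d : D (n + d)%N n = (h * (b ^ d).-1 * b ^ n)%N.
  have le : (y n <= y (n + d))%N by rewrite leq_mul2l leq_exp2l// leq_addr orbT.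
  by rewrite /D (eqP le) addn0 /y expnD -subn1; nia.
have row d : \sum_(n < N) B (D (n + d)%N n) <= N%:R * ((2 ^ J %| d)%N%:R + q).
  have [dJ|dJ] := boolP (2 ^ J %| d)%N.
    apply: (@le_trans _ _ N%:R).
      rewrite -[X in X%:R]card_ord -sum1_card natr_sum; apply: ler_sum => n _.
      exact: B1.
    by rewrite ler_peMr// lerDl.
  have d0 : (0 < d)%N by rewrite lt0n; apply: contraNneq dJ => ->.
  have bd : (0 < (b ^ d).-1)%N.
    by rewrite -subn1 subn_gt0 -(exp1n d) ltn_exp2r.
  have hb : (0 < h * (b ^ d).-1)%N by rewrite muln_gt0 h0.
  have lb := logn2_expB1 b s o d b1 s1 oo be d0.
  have ld : (logn 2 d < J)%N by rewrite ltnNge -pfactor_dvdn.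
  have aJ : ((logn 2 (h * (b ^ d).-1) + s).+1 <= logn 2 h + 2 * s + J)%N.
    by rewrite lognM//; lia.
  under eq_bigr do rewrite Dd.
  rewrite add0r; apply: le_trans (sum_frequencies_le P s o b _ i m L s1 oo ob be hb _) _.
    by apply: leq_trans hL; rewrite leq_add2r.
  by rewrite ler_wpM2l// hq.
apply: (@le_trans _ _ (\sum_(d < N) N%:R * ((2 ^ J %| d)%N%:R + q))).
  exact: ler_sum.
rewrite -mulr_sumr expr2 -mulrA ler_wpM2l// big_split /= mulrDr lerD//; last first.
  by rewrite sumr_const card_ord mulr_natl.
have -> : N = (m * 2 ^ (i.+1 - J) * 2 ^ J)%N by rewrite -mulnA -expnD subnK.
apply: le_trans (sum_multiples_le _ _ _) _; first by rewrite expn_gt0.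
by rewrite [X in X * _]natrM natrX -mulrA -exprMn divff// expr1n mulr1.
Qed.

End SecondMoment.

(** * Fejer kernels *)

Section Weyl.
Context {R : realType}.

(** Both the decay of the Fejer kernel away from the integers and its exact
    integration by sampling come from this telescoping sum. *)
Lemma sum_cos_arith (x t : R) (n : nat) :
  2 * sin (t / 2) * \sum_(j < n) cos (x + j%:R * t) =
  sin (x + n%:R * t - t / 2) - sin (x - t / 2).
Proof.
elim: n => [|n IH]; first by rewrite big_ord0 mulr0 mul0r addr0 subrr.
rewrite big_ord_recr /= mulrDr IH -(natr1 n).
set y := x + n%:R * t.
have -> : x + (n%:R + 1) * t - t / 2 = y + t / 2 by rewrite /y; field.
by rewrite (sinD y (t / 2)) (sinB y); ring.
Qed.

(** [H] times the usual Fejer kernel, of period 1 and mean [H]. *)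
Definition fejer (H : nat) (x : R) : R := energy (fun h => h%:R * (2 * pi * x)) H.

Lemma fejer_ge0 H x : 0 <= fejer H x. Proof. exact: energy_ge0. Qed.

Lemma fejer_le H x : sin (pi * x) ^+ 2 * fejer H x <= 2.
Proof.
set t := 2 * pi * x.
have tE : pi * x = t / 2 by rewrite /t; field.
have bound y : `|sin (pi * x) * \sum_(h < H) cos (y + h%:R * t)| <= 1.
  rewrite -(ler_pM2l (ltr0Sn R 1)) -[X in X * `|_|]ger0_norm// -normrM mulrA tE.
  rewrite sum_cos_arith mulr1; apply: le_trans (ler_normB _ _) _.
  by apply: le_trans (lerD (sin_max _) (sin_max _)) _; rewrite lexx.
have sq (z : R) : `|z| <= 1 -> z ^+ 2 <= 1.
  by move=> z1; rewrite -real_normK ?num_real// expr_le1.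
rewrite /fejer /energy -/t mulrDr -!exprMn; apply: le_trans (lerD (sq _ _) (sq _ _)) _.
- apply: le_trans (bound 0); rewrite le_eqVlt; apply/predU1P; left.
  by congr `|_ * _|; apply: eq_bigr => h _; rewrite add0r.
- apply: le_trans (bound (- (pi / 2))); rewrite le_eqVlt; apply/predU1P; left.
  by congr `|_ * _|; apply: eq_bigr => h _; rewrite addrC cosBpihalf.
- by rewrite lexx.
Qed.

Lemma fejerD_nat H x k : fejer H (x + k%:R) = fejer H x.
Proof.
rewrite /fejer /energy; congr (_ ^+ 2 + _ ^+ 2); apply: eq_bigr => h _.
  have -> : h%:R * (2 * pi * (x + k%:R)) = h%:R * (2 * pi * x) + (pi *+ 2) *+ (h * k) :> R.
    by rewrite -(mulr_natr (pi *+ 2)) -mulr_natr natrM; ring.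
  by rewrite periodicn//; exact: cosD2pi.
have -> : h%:R * (2 * pi * (x + k%:R)) = h%:R * (2 * pi * x) + (pi *+ 2) *+ (h * k) :> R.
  by rewrite -(mulr_natr (pi *+ 2)) -mulr_natr natrM; ring.
by rewrite periodicn//; exact: sinD2pi.
Qed.

Lemma fejerD_int H x (k : int) : fejer H (x + k%:~R) = fejer H x.
Proof.
case: k => k; first exact: fejerD_nat.
by rewrite -(fejerD_nat H _ k.+1) NegzE mulrNz subrK.
Qed.

Lemma sum_cos_roots (M k : nat) (x : R) : (0 < k < M)%N ->
  \sum_(j < M) cos (k%:R * (2 * pi * (x - j%:R / M%:R))) = 0.
Proof.
move=> /andP[k0 kM]; have M0 : (0 < M)%N by exact: leq_trans kM.
have Mn0 : M%:R != 0 :> R by rewrite pnatr_eq0 -lt0n.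
pose t : R := - (2 * pi * k%:R / M%:R).
have tE (j : nat) : k%:R * (2 * pi * (x - j%:R / M%:R)) = k%:R * (2 * pi * x) + j%:R * t.
  by rewrite /t; field.
under eq_bigr do rewrite tE.
have := sum_cos_arith (k%:R * (2 * pi * x)) t M.
have -> : M%:R * t = - ((pi *+ 2) *+ k).
  by rewrite /t -(mulr_natr (pi *+ 2)) -(mulr_natr pi); field.
have -> : k%:R * (2 * pi * x) - (pi *+ 2) *+ k - t / 2 =
  k%:R * (2 * pi * x) - t / 2 - (pi *+ 2) *+ k by ring.
set y := k%:R * (2 * pi * x) - t / 2.
rewrite -{2}(subrK ((pi *+ 2) *+ k) y) (periodicn (sinD2pi (R := R))) subrr => /eqP.
rewrite !mulf_eq0 pnatr_eq0 /= => /orP[/eqP s0|/eqP//].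
have : 0 < sin (pi * (k%:R / M%:R)) :> R.
  apply: sin_gt0_pi; rewrite mulr_gt0 ?pi_gt0 ?divr_gt0 ?ltr0n//=.
  by rewrite gtr_pMr ?pi_gt0// ltr_pdivrMr ?ltr0n// mul1r ltr_nat.
have -> : pi * (k%:R / M%:R) = - (t / 2) by rewrite /t; field.
by rewrite sinN s0 oppr0 ltxx.
Qed.

(** Sampling at the [M]-th roots of unity integrates exactly the trigonometric
    polynomials of degree less than [M]. *)
Lemma sum_fejer (M : nat) (x : R) :
  \sum_(j < M) fejer M (x - j%:R / M%:R) = M%:R ^+ 2.
Proof.
under eq_bigr do rewrite /fejer energyE.
rewrite exchange_big /=; transitivity (\sum_(h < M) (M%:R : R)); last first.
  by rewrite sumr_const card_ord -[LHS]mulr_natl expr2.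
apply: eq_bigr => h _.
rewrite exchange_big /= (bigD1 h)//= [X in _ + X]big1 ?addr0 => [|h' hh'].
  under eq_bigr do rewrite subrr cos0.
  by rewrite sumr_const card_ord.
under eq_bigr do rewrite cos_natdist.
apply: sum_cos_roots; apply/andP; split.
  rewrite addn_gt0 !subn_gt0 -neq_ltn; apply: contra hh' => /eqP e.
  exact/eqP/val_inj.
by have := ltn_ord h; have := ltn_ord h'; lia.
Qed.

Definition mean (f : nat -> R) (N : nat) : R := (\sum_(n < N) f n) / N%:R.

Definition weyl_null (u : nat -> R) := forall h, (0 < h)%N ->
  mean (fun n => cos (h%:R * (2 * pi * u n))) @ \oo --> 0 /\
  mean (fun n => sin (h%:R * (2 * pi * u n))) @ \oo --> 0.

(** Expanding the kernel in exponentials, all frequencies but zero average out. *)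
Lemma mean_fejer (u : nat -> R) (H : nat) (y : R) : weyl_null u ->
  mean (fun n => fejer H (u n - y)) @ \oo --> (H%:R : R).
Proof.
move=> wu.
have cosk k : (0 < k)%N ->
    mean (fun n => cos (k%:R * (2 * pi * (u n - y)))) @ \oo --> 0.
  move=> /wu[wc ws]; set z := k%:R * (2 * pi * y).
  have -> : mean (fun n => cos (k%:R * (2 * pi * (u n - y)))) =
      (fun N => cos z * mean (fun n => cos (k%:R * (2 * pi * u n))) N +
                sin z * mean (fun n => sin (k%:R * (2 * pi * u n))) N).
    apply/funext => N; rewrite /mean !mulrA -mulrDl !mulr_sumr -big_split /=.
    congr (_ / _); apply: eq_bigr => n _.
    have -> : k%:R * (2 * pi * (u n - y)) = k%:R * (2 * pi * u n) - z.
      by rewrite /z; ring.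
    by rewrite cosB mulrC [X in _ + X]mulrC.
  rewrite -[X in _ --> X](_ : cos z * 0 + sin z * 0 = 0); last by rewrite !mulr0 addr0.
  by apply: cvgD; apply: cvgM => //; exact: cvg_cst.
have -> : mean (fun n => fejer H (u n - y)) = (fun N => \sum_(h < H) \sum_(h' < H)
    mean (fun n => cos ((h - h' + (h' - h))%:R * (2 * pi * (u n - y)))) N).
  apply/funext => N; rewrite /mean /fejer.
  under eq_bigr do rewrite energyE.
  rewrite exchange_big mulr_suml; apply: eq_bigr => h _.
  rewrite exchange_big mulr_suml; apply: eq_bigr => h' _.
  by congr (_ / _); apply: eq_bigr => n _; rewrite cos_natdist.
have -> : H%:R = \sum_(h < H) \sum_(h' < H) (h == h')%:R :> R.
  transitivity (\sum_(h < H) (1 : R)); first by rewrite sumr_const card_ord.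
  apply: eq_bigr => h _; rewrite (bigD1 h)//= eqxx big1 ?addr0// => h' hh'.
  by rewrite eq_sym (negbTE hh').
apply: (@cvg_big _ _ +%R 0 xpredT) => [|h _]; first exact: add_continuous.
apply: (@cvg_big _ _ +%R 0 xpredT) => [|h' _]; first exact: add_continuous.
have [->|hh'] := eqVneq h h'; last first.
  apply: cosk; rewrite addn_gt0 !subn_gt0 orbC -neq_ltn.
  by apply: contra hh' => /eqP e; exact/eqP/val_inj.
apply: cvg_near_cst; exists 1%N => // N /= N0.
rewrite /mean; under eq_bigr do rewrite subnn mul0r cos0.
by rewrite sumr_const card_ord divff// pnatr_eq0 -lt0n.
Qed.

(** The first fractional digit in base [b]; the later digits of [x] are the first
    digits of the numbers [b ^ n * x]. *)
Definition cell (b : nat) (x : R) : nat := Num.truncn (b%:R * (x - (Num.floor x)%:~R)).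

Lemma frac_itv (x : R) : 0 <= x - (Num.floor x)%:~R < 1.
Proof.
by rewrite subr_ge0 floor_le_tmp /= ltrBlDl -intrD1 floorD1_gt.
Qed.

Lemma cell_lt b x : (0 < b)%N -> (cell b x < b)%N.
Proof.
move=> b0; have /andP[f0 f1] := frac_itv x.
by rewrite /cell truncn_lt_nat ?mulr_ge0// gtr_pMr// ltr0n.
Qed.

(** The kernels centred at all the [M] nodes have sum [M ^ 2] at every [x]. If the
    first digit of [x] is [c], the nodes outside the arc of such points widened by
    [delta] on both sides are at distance at least [delta] from [x] modulo 1, and
    their contribution is the error term. *)
Lemma cell_le_fejer (b q r c : nat) (x : R)
    (M := (b * q * r)%N) (delta : R := (b * q)%:R^-1) :
  (1 < b)%N -> (1 < q)%N -> (0 < r)%N ->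
  (cell b x == c)%:R <=
  M%:R ^- 2 * (\sum_(j < q * r + 2 * r) fejer M (x - (c%:R / b%:R - delta + j%:R / M%:R)))
  + 2 / (M%:R * sin (pi * delta) ^+ 2).
Proof.
move=> b1 q1 r0.
have b0 : (0 < b)%N by exact: ltnW.
have q0 : (0 < q)%N by exact: ltnW.
have bR : 0 < b%:R :> R by rewrite ltr0n.
have qR : 0 < q%:R :> R by rewrite ltr0n.
have rR : 0 < r%:R :> R by rewrite ltr0n.
have bR0 : b%:R != 0 :> R by rewrite gt_eqF.
have qR0 : q%:R != 0 :> R by rewrite gt_eqF.
have rR0 : r%:R != 0 :> R by rewrite gt_eqF.
have M0 : 0 < M%:R :> R by rewrite ltr0n !muln_gt0 b0 q0.
have d0 : 0 < delta by rewrite invr_gt0 ltr0n muln_gt0 b0.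
have d2 : delta <= 1 / 2.
  rewrite /delta div1r lef_pV2 ?posrE ?ltr0n ?muln_gt0 ?b0// ler_nat.
  by rewrite (leq_trans b1)// leq_pmulr.
have dM : delta = r%:R / M%:R.
  by rewrite /delta /M !natrM; field; rewrite bR0 qR0 rR0.
have bM : b%:R^-1 = (q * r)%:R / M%:R :> R.
  by rewrite /M !natrM; field; rewrite bR0 qR0 rR0.
have pi0 : 0 < pi :> R := pi_gt0 R.
have sd : 0 < sin (pi * delta).
  by apply: sin_gt0_pi; rewrite mulr_gt0//= gtr_pMr//; lra.
case: eqP => [cx|_]; last first.
  apply: addr_ge0; last by rewrite divr_ge0// mulr_ge0 ?sqr_ge0// ltW.
  rewrite mulr_ge0 ?invr_ge0 ?sqr_ge0//.
  by apply: sumr_ge0 => j _; exact: fejer_ge0.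
have /andP[f0 f1] := frac_itv x.
have /andP[c1 c2] := truncn_itv (mulr_ge0 (ltW bR) f0).
rewrite -/(cell b x) cx in c1 c2; set f := x - (Num.floor x)%:~R in f0 f1 c1 c2.
pose z := f - c%:R / b%:R.
have z0 : 0 <= z by rewrite subr_ge0 ler_pdivrMr// mulrC.
have z1 : z < b%:R^-1.
  by rewrite ltrBlDl -[X in _ + X]mul1r -mulrDl ltr_pdivlMr// natr1 mulrC.
have zE (j : nat) : fejer M (x - (c%:R / b%:R - delta + j%:R / M%:R)) =
    fejer M (z + delta - j%:R / M%:R).
  rewrite -[RHS](fejerD_int M _ (Num.floor x)); congr fejer.
  by rewrite /z /f; ring.
have qrM : (q * r + 2 * r <= M)%N.
  rewrite /M -mulnDl leq_mul2r; apply/orP; right.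
  apply: (@leq_trans (2 * q)%N); last by rewrite leq_mul2r b1 orbT.
  by rewrite mul2n -addnn leq_add2l.
under eq_bigr do rewrite zE.
have S2 : 0 < sin (pi * delta) ^+ 2 by rewrite exprn_gt0.
(* [t] lies between [-1 + delta] and [- delta], so that [x] is [delta]-far from
   the node on both sides, and the sine is smallest at the ends. *)
have far (j : nat) : (q * r + 2 * r <= j)%N -> (j < M)%N ->
    fejer M (z + delta - j%:R / M%:R) <= 2 / sin (pi * delta) ^+ 2.
  move=> j1 j2; set t := z + delta - _.
  have t1 : t <= - delta.
    suff : b%:R^-1 + 2 * delta <= j%:R / M%:R by rewrite /t; lra.
    rewrite bM dM mulrA -mulrDl ler_pM2r ?invr_gt0//.
    by rewrite -natrM -natrD ler_nat.
  have t2 : -1 + delta <= t.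
    have : j%:R / M%:R <= 1 :> R by rewrite ler_pdivrMr// mul1r ler_nat ltnW.
    by rewrite /t; lra.
  rewrite ler_pdivlMr// mulrC; apply: le_trans (fejer_le M t).
  rewrite ler_wpM2r ?fejer_ge0// -[leRHS]sqrrN ler_sqr ?nnegrE ?(ltW sd)//; last first.
    by rewrite -sinN sin_ge0_pi// -mulrN mulr_ge0 ?(ltW pi0)//=; [rewrite ger_pMr//; lra|lra].
  rewrite -sinN -mulrN.
  have [h|h] := leP (- t) (1 / 2).
    have [->//|ne] := eqVneq (- t) delta.
    apply: ltW; rewrite ltr_sin ?in_itv /=.
    - by rewrite ltr_pM2l// lt_neqAle eq_sym ne; lra.
    - by apply/andP; split; nra.
    - by apply/andP; split; nra.
  have -> : sin (pi * - t) = sin (pi * (1 + t)).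
    have -> : pi * (1 + t) = - (pi * - t) + pi by ring.
    by rewrite sinDpi sinN opprK.
  have [->//|ne] := eqVneq (1 + t) delta.
  apply: ltW; rewrite ltr_sin ?in_itv /=.
  - by rewrite ltr_pM2l// lt_neqAle eq_sym ne; lra.
  - by apply/andP; split; nra.
  - by apply/andP; split; nra.
have := sum_fejer M (z + delta).
rewrite -(big_mkord xpredT (fun j => fejer M (z + delta - j%:R / M%:R))).
rewrite (big_cat_nat (n := (q * r + 2 * r)%N))//= big_mkord.
set A := \sum_(j < _) _; set B := \sum_(_ <= j < _) _ => AB.
have hB : B <= M%:R * (2 / sin (pi * delta) ^+ 2).
  apply: (@le_trans _ _ (\sum_(q * r + 2 * r <= j < M) (2 / sin (pi * delta) ^+ 2))).
    by apply: ler_sum_nat => j /andP[j1 j2]; exact: far.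
  rewrite sumr_const_nat -[leLHS]mulr_natl ler_wpM2r ?ler_nat ?leq_subr//.
  by rewrite divr_ge0 ?(ltW S2).
have -> : 2 / (M%:R * sin (pi * delta) ^+ 2) =
    M%:R ^- 2 * (M%:R * (2 / sin (pi * delta) ^+ 2)).
  by field; rewrite !gt_eqF.
rewrite -mulrDr mulrC ler_pdivlMr ?exprn_gt0// mul1r -AB.
by rewrite lerD2l.
Qed.

End Weyl.

(** * Weyl's criterion and simple normality *)

Section Normality.
Context {R : realType}.

Lemma le_mean (f g : nat -> R) N : (forall n, f n <= g n) -> mean f N <= mean g N.
Proof. by move=> fg; rewrite ler_wpM2r ?invr_ge0// ler_sum. Qed.

Lemma mean_cst (K : R) N : (0 < N)%N -> mean (fun=> K) N = K.
Proof.
by move=> N0; rewrite /mean sumr_const card_ord -[K *+ N]mulr_natr mulfK// pnatr_eq0 -lt0n.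
Qed.

(** The average of the majorant of [cell_le_fejer] tends to the proportion of nodes
    in the widened arc, which exceeds [1 / b] by [2 * delta]. *)
Lemma cell_eventually_le (u : nat -> R) (b c : nat) (e : R) :
  weyl_null u -> (1 < b)%N -> 0 < e ->
  \forall N \near \oo, mean (fun n => (cell b (u n) == c)%:R) N <= b%:R^-1 + e.
Proof.
move=> wu b1 e0; have b0 : (0 < b)%N by exact: ltnW.
(* The widening [2 * delta] and the mass outside the widened arc each cost at most
   [e / 3]; the first determines [q], and then the second determines [r]. *)
pose q := (Num.truncn (6 / e)).+2.
pose delta : R := (b * q)%:R^-1.
have bR : 0 < b%:R :> R by rewrite ltr0n.
have qe : 6 / e < q%:R by apply: lt_trans (truncnS_gt _) _; rewrite ltr_nat.
have d0 : 0 < delta by rewrite invr_gt0 ltr0n muln_gt0 b0.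
have de : 2 * delta <= e / 3.
  rewrite /delta natrM invfM.
  have h1 : (b%:R : R)^-1 <= 1 by rewrite invf_le1// ler1n.
  have h2 : (q%:R : R)^-1 <= e / 6.
    by rewrite -[e / 6]invf_div lef_pV2 ?posrE ?divr_gt0// ltW.
  have h3 : 0 < (q%:R : R)^-1 by rewrite invr_gt0.
  by apply: le_trans (_ : 2 * q%:R^-1 <= _); [rewrite ler_pM2l// ler_piMl// ltW|lra].
have d2 : delta <= 1 / 2.
  rewrite /delta div1r lef_pV2 ?posrE ?ltr0n ?muln_gt0 ?b0// ler_nat.
  by rewrite (leq_trans b1)// leq_pmulr.
pose S2 := sin (pi * delta) ^+ 2.
have S20 : 0 < S2.
  rewrite exprn_gt0// sin_gt0_pi// mulr_gt0 ?pi_gt0//= gtr_pMr ?pi_gt0//.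
  by lra.
pose r := (Num.truncn (6 / (e * S2))).+1.
have re : 6 / (e * S2) < r%:R by exact: truncnS_gt.
pose M := (b * q * r)%N.
have M0 : (0 < M)%N by rewrite !muln_gt0 b0.
have MR : 0 < M%:R :> R by rewrite ltr0n.
have MS : 2 / (M%:R * S2) <= e / 3.
  rewrite (ler_pdivrMr _ _ (mulr_gt0 MR S20)).
  have rM : (r%:R : R) <= M%:R by rewrite ler_nat leq_pmull// muln_gt0 b0.
  have : 6 <= e * S2 * M%:R.
    rewrite -(ler_pdivrMl _ _ (mulr_gt0 e0 S20)).
    by apply: le_trans rM; rewrite mulrC ltW.
  have -> : e / 3 * (M%:R * S2) = e * S2 * M%:R / 3 by field.
  by lra.
pose g N := M%:R ^- 2 * (\sum_(j < q * r + 2 * r)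
  mean (fun n => fejer M (u n - (c%:R / b%:R - delta + j%:R / M%:R))) N)
  + 2 / (M%:R * S2).
have gcvg : g @ \oo --> M%:R ^- 2 * (\sum_(j < q * r + 2 * r) M%:R) + 2 / (M%:R * S2).
  apply: cvgD; last exact: cvg_cst.
  apply: cvgM; first exact: cvg_cst.
  apply: (@cvg_big _ _ +%R 0 xpredT) => [|j _]; first exact: add_continuous.
  exact: mean_fejer.
have lim_lt : M%:R ^- 2 * (\sum_(j < q * r + 2 * r) M%:R) + 2 / (M%:R * S2) < b%:R^-1 + e.
  have -> : M%:R ^- 2 * (\sum_(j < q * r + 2 * r) M%:R) = b%:R^-1 + 2 * delta :> R.
    rewrite sumr_const card_ord -[X in _ * X]mulr_natr /delta /M natrD !natrM.
    by field; rewrite !pnatr_eq0 -!lt0n b0.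
  by lra.
have g_le := cvgr_le _ gcvg _ lim_lt.
near=> N; have N0 : (0 < N)%N by near: N; exact: nbhs_infty_gt.
apply: (@le_trans _ _ (g N)); last by near: N; exact: g_le.
apply: (@le_trans _ _ (mean (fun n => M%:R ^- 2 * (\sum_(j < q * r + 2 * r)
    fejer M (u n - (c%:R / b%:R - delta + j%:R / M%:R))) + 2 / (M%:R * S2)) N)).
  by apply: le_mean => n; exact: cell_le_fejer.
rewrite /mean /g big_split /= mulrDl -[X in _ + X]/(mean (fun=> _) N) mean_cst// lerD2r.
rewrite -mulr_sumr exchange_big /= -mulrA mulr_suml.
exact: lexx.
Unshelve. all: by end_near.
Qed.

(** If no digit occurs too often, then none occurs too rarely, as the frequencies
    have sum 1. *)
Lemma frequency_of_upper (d : nat -> nat) (b : nat) :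
  (0 < b)%N -> (forall n, (d n < b)%N) ->
  (forall c (e : R), 0 < e ->
    \forall N \near \oo, mean (fun n => (d n == c)%:R) N <= b%:R^-1 + e) ->
  forall c, (c < b)%N -> mean (fun n => (d n == c)%:R) @ \oo --> (b%:R^-1 : R).
Proof.
move=> b0 db up c cb; have bR : 0 < b%:R :> R by rewrite ltr0n.
have total N : (0 < N)%N -> \sum_(a < b) mean (fun n => (d n == a)%:R) N = 1 :> R.
  move=> N0; rewrite -[RHS](mean_cst 1 N N0) /mean -mulr_suml exchange_big /=; congr (_ / _).
  apply: eq_bigr => n _; rewrite (bigD1 (Ordinal (db n)))//= eqxx big1 ?addr0// => a ha.
  by rewrite eq_sym; case: eqP => // e; rewrite -(inj_eq val_inj) /= e eqxx in ha.
apply/cvgrPdist_le => e e0.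
have e1 : 0 < e / b%:R by rewrite divr_gt0.
have upall : \forall N \near \oo, forall a : 'I_b,
    mean (fun n => (d n == a)%:R) N <= b%:R^-1 + e / b%:R.
  by apply: filter_forall => a; exact: up.
near=> N.
have N0 : (0 < N)%N by near: N; exact: nbhs_infty_gt.
have upN : forall a : 'I_b, mean (fun n => (d n == a)%:R) N <= b%:R^-1 + e / b%:R.
  by near: N.
have ub := upN (Ordinal cb); rewrite /= in ub.
have be : e / b%:R <= e by rewrite ler_pdivrMr// ler_peMr ?ler1n// ltW.
have lb : b%:R^-1 - e <= mean (fun n => (d n == c)%:R) N.
  have := total N N0; rewrite (bigD1 (Ordinal cb))//= => tot.
  have : \sum_(a < b | a != Ordinal cb) mean (fun n => (d n == a)%:R) N <=
      \sum_(a < b | a != Ordinal cb) (b%:R^-1 + e / b%:R).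
    by apply: ler_sum => a _; exact: upN.
  have -> : \sum_(a < b | a != Ordinal cb) (b%:R^-1 + e / b%:R) =
      b%:R * (b%:R^-1 + e / b%:R) - (b%:R^-1 + e / b%:R).
    transitivity (\sum_(a < b) (b%:R^-1 + e / b%:R) - (b%:R^-1 + e / b%:R)).
      by rewrite [in RHS](bigD1 (Ordinal cb))//= addrAC subrr add0r.
    by rewrite sumr_const card_ord -[X in X - _]mulr_natl.
  have -> : b%:R * (b%:R^-1 + e / b%:R) = 1 + e by field; rewrite gt_eqF.
  have : 0 <= e / b%:R by exact: ltW.
  by lra.
rewrite ler_norml; apply/andP; split; lra.
Unshelve. all: by end_near.
Qed.

Section Expansion.
Variables (b : nat) (x : R).
Hypothesis b1 : (1 < b)%N.

Let bR : 0 < b%:R :> R. Proof. by rewrite ltr0n ltnW. Qed.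

Let fracn n : R := b%:R ^+ n * x - (Num.floor (b%:R ^+ n * x))%:~R.

Let d n := cell b (b%:R ^+ n * x).

Let fracnS n : fracn n.+1 = b%:R * fracn n - (d n)%:R.
Proof.
have /andP[f0 f1] := frac_itv (b%:R ^+ n * x); rewrite -/(fracn n) in f0 f1.
have /andP[t0 t1] := truncn_itv (mulr_ge0 (ltW bR) f0).
rewrite -/(cell b (b%:R ^+ n * x)) -/(d n) in t0 t1.
set y := b%:R ^+ n * x; set m : int := b%:Z * Num.floor y + (d n)%:Z.
have mE : m%:~R = b%:R * (Num.floor y)%:~R + (d n)%:R :> R by rewrite intrD intrM.
have yS : b%:R ^+ n.+1 * x = b%:R * y by rewrite exprS mulrA.
rewrite -(natr1 (d n)) /fracn -/y mulrBr in t0 t1.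
have fm : Num.floor (b%:R * y) = m.
  by apply: floor_def; rewrite intrD mE; apply/andP; split; lra.
by rewrite /fracn yS fm mE -/y; ring.
Qed.

Let fracn_itv n : 0 <= fracn n < 1. Proof. exact: frac_itv. Qed.

(** The [n]-th remainder is the fractional part of [b ^ n * x] divided by [b ^ n].
    Under a tail of digits [b - 1] the distance of that fractional part to 1
    would be multiplied by [b] at each step, while staying at most 1. *)
Lemma expansion_cell : is_expansion b x (fun n => cell b (b%:R ^+ n * x)).
Proof.
split.
- by move=> n; apply: cell_lt; exact: ltnW.
- have partial : series (fun j => (d j)%:R * b%:R ^- j.+1 : R) =
      (fun n => x - (Num.floor x)%:~R - fracn n / b%:R ^+ n).
    apply/funext; elim=> [|n IH].
      by rewrite /series /= big_geq// /fracn expr0 mul1r divr1 subrr.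
    rewrite seriesSr IH fracnS exprS; field.
    by rewrite expf_neq0 gt_eqF.
  rewrite -/d partial -[X in _ --> X]subr0; apply: cvgB; first exact: cvg_cst.
  apply: (@squeeze_cvgr _ _ _ _ (fun=> 0) (fun n => (b%:R^-1) ^+ n)).
  + near=> n; have /andP[f0 f1] := fracn_itv n.
    rewrite divr_ge0 ?exprn_ge0 ?(ltW bR)//= exprVn ler_piMl ?invr_ge0 ?exprn_ge0 ?(ltW bR)//.
    exact: ltW.
  + exact: cvg_cst.
  + apply: cvg_expr; rewrite ger0_norm ?invr_ge0 ?(ltW bR)//.
    by rewrite invf_lt1// ltr1n.
- move=> [N tail].
  have fN k : 1 - fracn (N + k) = b%:R ^+ k * (1 - fracn N).
    elim: k => [|k IH]; first by rewrite addn0 expr0 mul1r.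
    rewrite addnS fracnS /d tail ?leq_addr// exprS -mulrA -IH -subn1 natrB ?(ltnW b1)//.
    by ring.
  have /andP[_ fN1] := fracn_itv N.
  have gap : 0 < 1 - fracn N by rewrite subr_gt0.
  pose k := (Num.truncn (1 - fracn N)^-1).+1.
  have h1 : (1 - fracn N)^-1 < k%:R by exact: truncnS_gt.
  have h2 : k%:R <= b%:R ^+ k :> R by rewrite -natrX ler_nat ltnW// ltn_expl.
  have /andP[h3 _] := fracn_itv (N + k).
  have := fN k; have : 1 < k%:R * (1 - fracn N) by rewrite -ltr_pdivrMr// mul1r.
  have : k%:R * (1 - fracn N) <= b%:R ^+ k * (1 - fracn N) by rewrite ler_pM2r.
  by lra.
Unshelve. all: by end_near.
Qed.

End Expansion.

Lemma weyl_simply_normal (b : nat) (x : R) : (1 < b)%N ->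
  weyl_null (fun n => b%:R ^+ n * x) -> simply_normal b x.
Proof.
move=> b1 wx; exists (fun n => cell b (b%:R ^+ n * x)); first exact: expansion_cell.
move=> c cb; rewrite /has_frequency.
have -> : (fun n => (count (fun j => cell b (b%:R ^+ j * x) == c) (iota 0 n))%:R / n%:R : R) =
    mean (fun n => (cell b (b%:R ^+ n * x) == c)%:R).
  apply/funext => n; rewrite /mean; congr (_ / _).
  rewrite -sum1_count natr_sum -(big_mkord xpredT (fun j => (cell b (b%:R ^+ j * x) == c)%:R)).
  rewrite /index_iota subn0 big_mkcond; apply: eq_bigr => j _.
  by case: ifP.
apply: frequency_of_upper => //; first exact: ltnW.
  by move=> n; apply: cell_lt; exact: ltnW.
by move=> a e e0; exact: cell_eventually_le.
Qed.

End Normality.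

(** * Savings provided by sparsity *)

Section SparseDecay.
Context {R : realType}.

Lemma sparse_window (S : set nat) (rho : R) : sparsity_exponent S rho ->
  \forall k \near \oo, forall a, a%:R <= k%:R `^ rho :> R ->
    30 * ln k%:R <= (count_in S a (a + k))%:R :> R.
Proof.
move=> [rho0]; rewrite limn_einf_lim => lim1.
have [n hn] : exists n, (1 < einfs (min_ratio S rho) n)%E.
  apply: contrapT => nn; move: lim1; apply/negP; rewrite -leNgt.
  apply: lime_le; first exact: is_cvg_einfs.
  apply: nearW => k; rewrite leNgt; apply/negP => hk; apply: nn.
  by exists k.
near=> k => a ak.
have k1 : (1 < k)%N by near: k; exact: nbhs_infty_gt.
have nk : (n <= k)%N by near: k; exact: nbhs_infty_ge.
have : (1 < min_ratio S rho k)%E.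
  by apply: lt_le_trans hn _; apply: ereal_inf_lbound; exists k.
rewrite /min_ratio big_mkord => min1.
have aT : (a < (Num.truncn (k%:R `^ rho : R)).+1)%N.
  by rewrite ltnS truncn_ge_nat// powR_ge0.
have := lt_le_trans min1 (bigmin_le _ (Ordinal aT) _).
rewrite /= lte_fin => /ltW; rewrite ler_pdivlMr ?mul1r//.
by rewrite mulr_gt0// ln_gt0// ltr1n.
Unshelve. all: by end_near.
Qed.

(** With [l] the integer logarithm of [k], [k ^ rho >= expR (rho * l / 2)] because
    [ln 2 >= 1 / 2], and this exponential is at least [(rho * l / 4) ^ 2]. *)
Lemma log_le_powR (rho : R) (C : nat) : 0 < rho ->
  \forall k \near \oo, (C + 4 * (trunc_log 2 k).+1)%:R <= k%:R `^ rho :> R.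
Proof.
move=> rho0.
have r2 : 0 < rho ^+ 2 by rewrite exprn_gt0.
pose l0 := (Num.truncn (16 * (C + 8)%:R / rho ^+ 2)).+1.
near=> k; set l := trunc_log 2 k.
have kl : (2 ^ l0 <= k)%N by near: k; exact: nbhs_infty_ge.
have l0l : (l0 <= l)%N by exact: trunc_log_max.
have k0 : (0 < k)%N by apply: leq_trans kl; rewrite expn_gt0.
have lk : (2 ^ l <= k)%N by exact: trunc_logP.
have ln2 : 1 / 2 <= ln (2 : R).
  have := @le_ln1Dx R (- (1 / 2)); rewrite (_ : 1 + - (1 / 2) = 2^-1); last by field.
  by rewrite lnV ?posrE// => h; have := h ltac:(lra); lra.
have lnk : l%:R * (1 / 2) <= ln (k%:R : R).
  apply: (@le_trans _ _ (ln (2 ^+ l))).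
    by rewrite lnXn// -[leRHS]mulr_natl ler_wpM2l.
  by rewrite ler_ln ?posrE ?exprn_gt0 ?ltr0n// -natrX ler_nat.
have lR : 16 * (C + 8)%:R / rho ^+ 2 <= l%:R.
  by apply: le_trans (ltW (truncnS_gt _)) _; rewrite ler_nat.
rewrite /powR pnatr_eq0 gtn_eqF//.
apply: (@le_trans _ _ (expR (rho * l%:R / 4) ^+ 2)); last first.
  rewrite -expRM_natl ler_expR; have := ler_wpM2l (ltW rho0) lnk; lra.
have x0 : 0 <= rho * l%:R / 4 by rewrite divr_ge0// mulr_ge0// ltW.
apply: (@le_trans _ _ ((rho * l%:R / 4) ^+ 2)); last first.
  rewrite ler_sqr ?nnegrE ?expR_ge0//.
  by apply: le_trans (expR_ge1Dx _); rewrite lerDr.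
have l1 : (0 < l)%N by exact: leq_trans l0l.
apply: (@le_trans _ _ ((C + 8)%:R * l%:R)).
  by rewrite -natrM ler_nat; nia.
rewrite ler_pdivrMr// in lR.
have := ler_wpM2r (ler0n R l) lR.
have -> : (rho * l%:R / 4) ^+ 2 = l%:R * rho ^+ 2 * l%:R / 16 :> R by field.
by lra.
Unshelve. all: by end_near.
Qed.

Lemma expR_quarter_ge (n : nat) : (3 / 4 : R) ^+ n <= expR (- (n%:R / 4)).
Proof.
have -> : - (n%:R / 4) = n%:R * (- (1 / 4)) :> R by field.
rewrite expRM_natl lerXn2r ?nnegrE ?expR_ge0//.
by have := expR_ge1Dx (- (1 / 4) : R); lra.
Qed.

(** A window starting below [k ^ rho] contains at least [30 * ln k] elements of [S],
    and [(3 / 4) ^ (30 * ln k) <= expR (- 30 / 4 * ln k)], which is at most [k ^- 4]. *)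
Lemma sparse_decay (S : set nat) (rho : R) (C : nat) : sparsity_exponent S rho ->
  \forall k \near \oo, forall a, (a <= C + 4 * (trunc_log 2 k).+1)%N ->
    (3 / 4 : R) ^+ count (fun n => n \in S) (index_iota a (a + k.+1)) <= k%:R ^- 4.
Proof.
move=> Srho; near=> k => a ak.
have k1 : (1 < k)%N by near: k; exact: nbhs_infty_gt.
have kR : 0 < k%:R :> R by rewrite ltr0n ltnW.
have win : forall a, a%:R <= k%:R `^ rho :> R ->
    30 * ln k%:R <= (count_in S a (a + k))%:R :> R.
  by near: k; exact: sparse_window.
have Ck : (C + 4 * (trunc_log 2 k).+1)%:R <= k%:R `^ rho :> R.
  by near: k; apply: log_le_powR; case: Srho.
have {}ak : a%:R <= k%:R `^ rho :> R by apply: le_trans Ck; rewrite ler_nat.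
have := win a ak; rewrite /count_in -addnS; set n := count _ _ => h.
apply: le_trans (expR_quarter_ge n) _.
have lk : 0 <= ln (k%:R : R) by rewrite ln_ge0// ler1n ltnW.
have -> : k%:R ^- 4 = expR (- (4 * ln k%:R)) :> R.
  by rewrite expRN (expRM_natl 4) lnK.
by rewrite ler_expR; lra.
Unshelve. all: by end_near.
Qed.

(** The lengths [m * 2 ^ k.+2] with [k <= m < 2 * k.+1] cover a range of ratio
    about 2 in steps of relative size at most [1 / k]. Being [O(k)] in number,
    they may be summed without harm to the decay in [k]. *)
Definition scale_energy (P : pred nat) (b h k L : nat) (w : nat -> bool) : R :=
  \sum_(m < 2 * k.+1)
    energy (fun n => 2 * pi * (h * b ^ n)%:R * truncated P L w) (m * 2 ^ k.+2)
    / (m * 2 ^ k.+2)%:R ^+ 2.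

Lemma scale_energy_ge0 P b h k L w : 0 <= scale_energy P b h k L w.
Proof.
by apply: sumr_ge0 => m _; rewrite divr_ge0 ?energy_ge0 ?sqr_ge0.
Qed.

(** With [J] about [4 * log2 k], both the proportion [2 ^- J] of exceptional
    differences and the saving are at most [k ^- 4], and the sum over the
    [2 * k.+1] lengths is [O(k ^- 3)]. *)
Lemma avg_scale_energy_le (S : set nat) (rho : R) (b h : nat) :
  sparsity_exponent S rho -> (1 < b)%N -> odd b -> (0 < h)%N ->
  \forall k \near \oo, forall L, (2 * k < L)%N ->
    avg L (scale_energy (fun n => n \in S) b h k L) <= k.+1%:R ^- 2.
Proof.
move=> Srho b1 ob h0.
have [r [z [r1 oz be]]] := sqr_odd_expansion b b1 ob.
pose C := (logn 2 h + 2 * r)%N.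
near=> k => L kL.
have k64 : (64 <= k)%N by near: k; exact: nbhs_infty_ge.
have kR : 0 < k%:R :> R by rewrite ltr0n; exact: leq_trans k64.
have dec : forall a, (a <= C + 4 * (trunc_log 2 k).+1)%N ->
    (3 / 4 : R) ^+ count (fun n => n \in S) (index_iota a (a + k.+1)) <= k%:R ^- 4.
  by near: k; exact: (sparse_decay _ _ _ Srho).
have CJ : (C + 4 * (trunc_log 2 k).+1 <= k)%N.
  rewrite -(ler_nat R) -[leRHS]powRr1//; near: k; exact: log_le_powR.
set J := (4 * (trunc_log 2 k).+1)%N in dec CJ *.
have J4 : (2^-1 : R) ^+ J <= k%:R ^- 4.
  rewrite exprVn lef_pV2 ?posrE ?exprn_gt0// /J mulnC exprM -(natrX _ 2).
  by rewrite lerXn2r ?nnegrE// ler_nat ltnW// trunc_log_ltn.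
pose q : R := k%:R ^- 4.
have q0 : 0 < q by rewrite invr_gt0 exprn_gt0.
have term (m : nat) : avg L (fun w =>
    energy (fun n => 2 * pi * (h * b ^ n)%:R * truncated (fun n => n \in S) L w)
      (m * 2 ^ k.+2) / (m * 2 ^ k.+2)%:R ^+ 2) <= 4 * q.
  set N := (m * 2 ^ k.+2)%N.
  pose f w : R :=
    energy (fun n => 2 * pi * (h * b ^ n)%:R * truncated (fun n => n \in S) L w) N.
  rewrite (eq_avg _ _ (fun w => N%:R ^- 2 * f w)) => [|w]; last by rewrite mulrC.
  rewrite avgZ.
  have [->|N0] := eqVneq N 0%N; first by rewrite expr0n invr0 mul0r mulr_ge0 ?ltW.
  have NR : 0 < N%:R :> R by rewrite ltr0n lt0n.
  rewrite ler_pdivrMl ?exprn_gt0//.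
  apply: le_trans (avg_energy_le (fun n => n \in S) h b r z J m k.+1 L q h0 b1 ob r1 oz be _ _ dec) _.
  - by apply: leq_trans (_ : (k <= _)%N); rewrite ?leqW// (leq_trans _ CJ)// leq_addl.
  - by rewrite -/C; lia.
  rewrite -/N (_ : N%:R ^+ 2 * (4 * q) = 2 * N%:R ^+ 2 * (2 * q)); last by ring.
  by rewrite ler_pM2l ?mulr_gt0 ?exprn_gt0//; rewrite -/q in J4; lra.
rewrite /scale_energy avg_sum.
apply: (@le_trans _ _ (\sum_(m < 2 * k.+1) 4 * q)); first by apply: ler_sum => m _.
rewrite sumr_const card_ord -[leLHS]mulr_natl natrM /q.
rewrite -[leRHS]mul1r ler_pdivlMr ?exprn_gt0// mulrA -!mulrA.
have -> : 2 * (k.+1%:R * (4 * (k%:R ^- 4 * k.+1%:R ^+ 2))) =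
    8 * k.+1%:R ^+ 3 / k%:R ^+ 4 :> R by field; rewrite gt_eqF.
rewrite ler_pdivrMr ?exprn_gt0// mul1r.
have k2 : k.+1%:R <= 2 * k%:R :> R.
  by rewrite -natrM ler_nat; lia.
have kc : k.+1%:R ^+ 3 <= (2 * k%:R) ^+ 3 :> R by rewrite lerXn2r ?nnegrE// mulr_ge0.
have k64R : 64 <= k%:R :> R by rewrite ler_nat.
apply: (@le_trans _ _ (64 * k%:R ^+ 3)).
  have -> : 64 * k%:R ^+ 3 = 8 * (2 * k%:R) ^+ 3 :> R by ring.
  by rewrite ler_pM2l.
by rewrite (exprS _ 3) ler_pM2r ?exprn_gt0.
Unshelve. all: by end_near.
Qed.

End SparseDecay.

(** * Points of the Cantor set *)

Section CantorPoints.
Context {R : realType}.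
Variable P : pred nat.
Implicit Types w : nat -> bool.

Let term w k : R := (w k)%:R * ((P k)%:R / 2 ^+ k).

Let term_ge0 w k : 0 <= term w k.
Proof. by rewrite mulr_ge0 ?divr_ge0 ?exprn_ge0. Qed.

Let term_le w k : term w k <= 2 ^- k.
Proof.
rewrite /term mulrA ler_piMl ?invr_ge0 ?exprn_ge0//.
by case: (w k); case: (P k); rewrite ?mulr0 ?mul0r ?mulr1.
Qed.

Lemma truncatedS n w : truncated P n.+1 w = truncated P n w + term w n.
Proof. by rewrite /truncated big_ord_recr. Qed.

Lemma truncated_mono w : nondecreasing_seq (fun n => truncated P n w : R).
Proof.
by apply/nondecreasing_seqP => n; rewrite truncatedS lerDl; exact: term_ge0.
Qed.

(** The missing position [j] keeps the tail below its maximal value by [2 ^- j];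
    this is what makes the bounds on the points of the Cantor set strict. *)
Lemma truncated_tail (L j n : nat) w : (L <= j)%N -> ~~ P j -> (j < n)%N ->
  truncated P n w <= truncated P L w + 2 * 2 ^- L - 2 ^- j :> R.
Proof.
move=> Lj Pj jn.
have half k : 2 * 2 ^- k.+1 = 2 ^- k :> R.
  by rewrite exprS invfM mulrA divff// mul1r.
have tail k d : truncated P (k + d) w <= truncated P k w + 2 * 2 ^- k - 2 * 2 ^- (k + d) :> R.
  elim: d => [|d IH]; first by rewrite addn0 addrK.
  rewrite addnS truncatedS half; have := term_le w (k + d); lra.
have := tail L (j - L)%N; rewrite subnKC// => h1.
have := tail j.+1 (n - j.+1)%N; rewrite subnKC// truncatedS half.
have -> : term w j = 0 by rewrite /term (negbTE Pj) mul0r mulr0.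
have : 0 < 2 ^- n :> R by rewrite invr_gt0 exprn_gt0.
by lra.
Qed.

Hypothesis Pgap : forall L, exists2 j, (L <= j)%N & ~~ P j.

Lemma truncated_bound (L n : nat) w :
  truncated P n w <= truncated P L w + 2 * 2 ^- L :> R.
Proof.
have [j Lj Pj] := Pgap L.
have : truncated P n w <= truncated P (maxn n j.+1) w :> R.
  by apply: truncated_mono; exact: leq_maxl.
have := truncated_tail L j (maxn n j.+1) w Lj Pj (leq_maxr _ _).
have : 0 < 2 ^- j :> R by rewrite invr_gt0 exprn_gt0.
by lra.
Qed.

Definition cantor_point w : R := limn (fun n => truncated P n w : R).

Lemma truncated_cvg w : (fun n => truncated P n w : R) @ \oo --> cantor_point w.
Proof.
apply: nondecreasing_is_cvgn; first exact: truncated_mono.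
by exists (truncated P 0 w + 2 * 2 ^- 0) => _ [n _ <-]; exact: truncated_bound.
Qed.

Lemma truncated_le_point n w : truncated P n w <= cantor_point w.
Proof.
apply: nondecreasing_cvgn_le; first exact: truncated_mono.
by apply/cvg_ex; exists (cantor_point w); exact: truncated_cvg.
Qed.

Lemma cantor_point_lt L w : cantor_point w < truncated P L w + 2 * 2 ^- L.
Proof.
have [j Lj Pj] := Pgap L.
apply: (@le_lt_trans _ _ (truncated P L w + 2 * 2 ^- L - 2 ^- j)); last first.
  by rewrite ltrBlDr ltrDl invr_gt0 exprn_gt0.
apply: limr_le; first by apply/cvg_ex; exists (cantor_point w); exact: truncated_cvg.
by exists j.+1 => // n /= jn; exact: truncated_tail.
Qed.

Lemma cantor_point_itv w : ~~ P 0 -> 0 <= cantor_point w < 1.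
Proof.
move=> P0; have t1 : truncated P 1 w = 0 :> R.
  by rewrite /truncated big_ord1 (negbTE P0) mul0r mulr0.
apply/andP; split; first by rewrite -t1 truncated_le_point.
by have := cantor_point_lt 1 w; rewrite t1 add0r expr1 divff.
Qed.

(** At the first position of [P] where they differ, the expansion with the bit 1
    wins: the other one could only catch up with a tail of ones, which the
    positions missing from [P] exclude. *)
Lemma cantor_point_inj w w' k : P k -> w k != w' k -> cantor_point w != cantor_point w'.
Proof.
move=> Pk wk.
have [m [Pm wm min]] : exists m, [/\ P m, w m != w' m &
    forall i, (i < m)%N -> P i -> w i = w' i].
  have ex : exists m, P m && (w m != w' m) by exists k; rewrite Pk.
  have [m /andP[Pm wm] mmin] := ex_minnP ex; exists m; split => // i im Pi.
  apply/eqP; apply: contraTT im => wi; rewrite -leqNgt.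
  by apply: mmin; rewrite Pi.
have same : truncated P m w = truncated P m w' :> R.
  apply: eq_bigr => i _; case Pi: (P i); last by rewrite mul0r !mulr0.
  by rewrite min.
have main (v v' : nat -> bool) : v m -> ~~ v' m -> truncated P m v = truncated P m v' :> R ->
    cantor_point v' < cantor_point v.
  move=> vm vm' e; apply: lt_le_trans (truncated_le_point m.+1 v).
  apply: lt_le_trans (cantor_point_lt m.+1 v') _.
  rewrite !truncatedS e /term vm (negbTE vm') Pm mul0r mul1r addr0 div1r.
  by rewrite exprS invfM mulrA divff// mul1r.
case vm: (w m) (wm) => [|]; case vm': (w' m) => // _.
  by rewrite gt_eqF// main ?vm ?vm'.
by rewrite lt_eqF// main ?vm ?vm'.
Qed.

Lemma cos_lipschitz (x y : R) : `|cos x - cos y| <= `|x - y|.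
Proof.
wlog xy : x y / x <= y.
  by move=> H; have [/H//|/ltW/H] := leP x y; rewrite distrC (distrC y).
have [c _ e] : exists2 c, c \in `[x, y]%R & cos y - cos x = - sin c * (y - x).
  apply: (@MVT_segment _ cos (fun c => - sin c)) => //.
  exact/continuous_subspaceT/continuous_cos.
by rewrite distrC e (distrC x) normrM normrN ler_piMl// sin_max.
Qed.

Lemma sin_lipschitz (x y : R) : `|sin x - sin y| <= `|x - y|.
Proof.
rewrite -!cosBpihalf; apply: le_trans (cos_lipschitz _ _) _.
by rewrite opprB addrA subrK.
Qed.

(** A number of bits so large that the other bits change the phases of the
    exponential sums at the scale [k] by at most [1 / k.+1]; the factor 16
    bounds [4 * pi]. *)
Definition precision (b h k : nat) : nat :=
  (k.+1 * (16 * (h * b ^ (2 * k.+1 * 2 ^ k.+2))))%N.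

Lemma precision_gt b h k : (0 < h)%N -> (1 < b)%N -> (2 * k < precision b h k)%N.
Proof.
move=> h0 b1; have : (0 < h * b ^ (2 * k.+1 * 2 ^ k.+2))%N.
  by rewrite muln_gt0 h0 expn_gt0 ltnW.
by rewrite /precision; set y := (h * _)%N; nia.
Qed.

Lemma phase_error (b h k n : nat) w : (0 < h)%N -> (1 < b)%N -> (n < 2 * k.+1 * 2 ^ k.+2)%N ->
  `|h%:R * (2 * pi * (b%:R ^+ n * cantor_point w)) -
    2 * pi * (h * b ^ n)%:R * truncated P (precision b h k) w| <= k.+1%:R^-1.
Proof.
move=> h0 b1 nk; set L := precision b h k.
set y := (h * b ^ (2 * k.+1 * 2 ^ k.+2))%N.
have y0 : (0 < y)%N by rewrite muln_gt0 h0 expn_gt0 ltnW.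
have hy : (h * b ^ n <= y)%N by rewrite leq_mul2l leq_pexp2l ?orbT ?(ltnW b1)// ltnW.
have -> : h%:R * (2 * pi * (b%:R ^+ n * cantor_point w)) -
    2 * pi * (h * b ^ n)%:R * truncated P L w =
    2 * pi * (h * b ^ n)%:R * (cantor_point w - truncated P L w).
  by rewrite natrM natrX; ring.
have d0 : 0 <= cantor_point w - truncated P L w by rewrite subr_ge0 truncated_le_point.
have d1 : cantor_point w - truncated P L w <= 2 * 2 ^- L.
  by have := cantor_point_lt L w; lra.
have pi4 : pi <= 4 :> R by have := pihalf_lt2 R; lra.
have pi0 := pi_ge0 R.
rewrite ger0_norm ?mulr_ge0//.
apply: (@le_trans _ _ (8 * y%:R * (2 * 2 ^- L))).
  apply: ler_pM => //; first by rewrite !mulr_ge0.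
  by apply: ler_pM; rewrite ?mulr_ge0 ?ler_nat//; lra.
have L0 : (0 < L)%N by exact: leq_ltn_trans (precision_gt b h k h0 b1).
have -> : 8 * y%:R * (2 * 2 ^- L) = 16 * y%:R / 2 ^+ L :> R by ring.
rewrite ler_pdivrMr ?exprn_gt0// ler_pdivlMl//.
by rewrite -natrX -!natrM ler_nat ltnW// ltn_expl.
Qed.

(** The scale [k] is the largest one with [k * 2 ^ k.+2 <= N], and
    [m * 2 ^ k.+2] is [N] rounded down; the rounding loses less than
    [2 ^ k.+2 <= N / k]. *)
Lemma scale_exists (N K : nat) : (K * 2 ^ K.+2 <= N)%N ->
  exists k m, [/\ (K <= k)%N, (m < 2 * k.+1)%N, (m * 2 ^ k.+2 <= N)%N,
    (k * (N - m * 2 ^ k.+2) <= N)%N & (k <= m)%N].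
Proof.
move=> KN.
have ex : exists k, (k * 2 ^ k.+2 <= N)%N by exists K.
have ub k : (k * 2 ^ k.+2 <= N)%N -> (k <= N)%N.
  by apply: leq_trans; rewrite leq_pmulr// expn_gt0.
have [k kN kmax] := ex_maxnP ex ub.
exists k, (N %/ 2 ^ k.+2)%N.
have p0 : (0 < 2 ^ k.+2)%N by rewrite expn_gt0.
split.
- exact: kmax.
- rewrite ltn_divLR//; apply: contraT; rewrite -leqNgt => h.
  have /kmax : (k.+1 * 2 ^ k.+3 <= N)%N.
    by apply: leq_trans h; rewrite (expnS _ k.+2) mulnA (mulnC 2).
  by rewrite ltnn.
- exact: leq_divM.
- apply: leq_trans kN; rewrite leq_mul2l.
  by rewrite {1}(divn_eq N (2 ^ k.+2)) addKn ltnW ?orbT// ltn_pmod.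
- by rewrite leq_divRL.
Qed.

(** Meant for [g] the cosine or the sine. The three errors come from the energy at
    the rounded length, from the truncation of the bits, and from the rounding of
    the length. *)
Lemma trig_mean_le (g : R -> R) (b h k m N : nat) (e : R) w :
  (forall x y, `|g x - g y| <= `|x - y|) -> (forall x, `|g x| <= 1) ->
  (forall (t : nat -> R) n, (\sum_(i < n) g (t i)) ^+ 2 <= energy t n) ->
  (0 < h)%N -> (1 < b)%N -> 0 <= e -> (0 < k)%N -> (k <= m)%N ->
  (m < 2 * k.+1)%N -> (m * 2 ^ k.+2 <= N)%N -> (k * (N - m * 2 ^ k.+2) <= N)%N ->
  scale_energy P b h k (precision b h k) w <= e ^+ 2 ->
  `|mean (fun n => g (h%:R * (2 * pi * (b%:R ^+ n * cantor_point w)))) N| <=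
  e + 2 / k%:R.
Proof.
move=> glip g1 gE h0 b1 e0 k0 km mk N'N kN hF.
set L := precision b h k; set N' := (m * 2 ^ k.+2)%N in N'N kN *.
have N'0 : (0 < N')%N by rewrite muln_gt0 expn_gt0 (leq_trans k0).
have N0 : (0 < N)%N by exact: leq_trans N'N.
have NR : 0 < N%:R :> R by rewrite ltr0n.
have N'R : 0 < N'%:R :> R by rewrite ltr0n.
have kR : 0 < k%:R :> R by rewrite ltr0n.
pose t n : R := 2 * pi * (h * b ^ n)%:R * truncated P L w.
pose u n : R := h%:R * (2 * pi * (b%:R ^+ n * cantor_point w)).
have part : energy t N' <= (e * N'%:R) ^+ 2.
  rewrite exprMn -ler_pdivrMr ?exprn_gt0//; apply: le_trans hF.
  rewrite /scale_energy (bigD1 (Ordinal mk))//= lerDl sumr_ge0// => i _.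
  by rewrite divr_ge0 ?energy_ge0 ?sqr_ge0.
have trunc_le : `|\sum_(n < N') g (t n)| <= e * N'%:R.
  have eN : 0 <= e * N'%:R by rewrite mulr_ge0.
  rewrite -ler_sqr ?nnegrE// real_normK ?num_real//.
  exact: le_trans (gE _ _) part.
have diff_le : `|\sum_(n < N') (g (u n) - g (t n))| <= N'%:R / k%:R.
  apply: le_trans (ler_norm_sum _ _ _) _.
  apply: (@le_trans _ _ (\sum_(n < N') k%:R^-1)); last first.
    by rewrite sumr_const card_ord -[leLHS]mulr_natl.
  apply: ler_sum => n _; apply: le_trans (glip _ _) _.
  apply: (@le_trans _ _ k.+1%:R^-1); last by rewrite lef_pV2 ?posrE// ler_nat.
  apply: phase_error => //; apply: leq_trans (ltn_ord n) _.
  by rewrite /N' leq_mul2r ltnW ?orbT.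
have rest_le : `|\sum_(N' <= n < N) g (u n)| <= N%:R / k%:R.
  apply: le_trans (ler_norm_sum _ _ _) _.
  apply: (@le_trans _ _ (\sum_(N' <= n < N) 1)); first by apply: ler_sum => n _.
  by rewrite sumr_const_nat ler_pdivlMr// -natrM ler_nat mulnC.
rewrite /mean normrM normfV (ger0_norm (ltW NR)) ler_pdivrMr//.
rewrite -(big_mkord xpredT (fun n => g (u n))) (big_cat_nat (n := N'))//= big_mkord.
have -> : \sum_(i < N') g (u i) =
    \sum_(n < N') (g (u n) - g (t n)) + \sum_(n < N') g (t n).
  by rewrite -big_split /=; apply: eq_bigr => n _; rewrite subrK.
apply: le_trans (ler_normD _ _) _; apply: le_trans (lerD (ler_normD _ _) (lexx _)) _.
have N'NR : N'%:R <= N%:R :> R by rewrite ler_nat.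
have e1 : e * N'%:R <= e * N%:R by rewrite ler_wpM2l.
have e2 : N'%:R / k%:R <= N%:R / k%:R :> R by rewrite ler_pM2r ?invr_gt0.
have -> : (e + 2 / k%:R) * N%:R = e * N%:R + 2 * (N%:R / k%:R) by field; rewrite gt_eqF.
by lra.
Qed.

Lemma trig_mean_cvg (g : R -> R) (b h : nat) w :
  (forall x y, `|g x - g y| <= `|x - y|) -> (forall x, `|g x| <= 1) ->
  (forall (t : nat -> R) n, (\sum_(i < n) g (t i)) ^+ 2 <= energy t n) ->
  (0 < h)%N -> (1 < b)%N ->
  scale_energy P b h k (precision b h k) w @[k --> \oo] --> (0 : R) ->
  mean (fun n => g (h%:R * (2 * pi * (b%:R ^+ n * cantor_point w)))) @ \oo --> 0.
Proof.
move=> glip g1 gE h0 b1 F0; apply/cvgrPdist_le => e e0.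
have e20 : 0 < e / 2 by rewrite divr_gt0.
have [K _ hK] := cvgr_le _ F0 _ (exprn_gt0 2 e20).
pose K' := maxn K (Num.truncn (4 / e)).+1.
exists (K' * 2 ^ K'.+2)%N => // N /= /scale_exists[k [m [Kk mk N'N kN km]]].
rewrite sub0r normrN.
have k0 : (0 < k)%N by apply: leq_trans Kk; rewrite leq_max orbT.
apply: (@le_trans _ _ (e / 2 + 2 / k%:R)).
  apply: (trig_mean_le g b h k m N (e / 2)) => //; first exact: ltW.
  by apply: hK => /=; apply: leq_trans Kk; exact: leq_maxl.
have ke : 4 / e <= k%:R.
  apply: le_trans (ltW (truncnS_gt _)) _; rewrite ler_nat.
  by apply: leq_trans Kk; exact: leq_maxr.
have : 2 / k%:R <= e / 2.
  rewrite ler_pdivrMr ?ltr0n//; rewrite ler_pdivrMr// in ke.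
  have -> : e / 2 * k%:R = k%:R * e / 2 by ring.
  by lra.
by lra.
Qed.

Lemma weyl_null_point (b : nat) w : (1 < b)%N ->
  (forall h, (0 < h)%N ->
    scale_energy P b h k (precision b h k) w @[k --> \oo] --> (0 : R)) ->
  weyl_null (fun n => b%:R ^+ n * cantor_point w).
Proof.
move=> b1 F0 h h0; split; apply: trig_mean_cvg => //; try exact: F0.
- exact: cos_lipschitz.
- exact: cos_max.
- by move=> t n; rewrite /energy lerDl sqr_ge0.
- exact: sin_lipschitz.
- exact: sin_max.
- by move=> t n; rewrite /energy lerDr sqr_ge0.
Qed.

End CantorPoints.

(** * Existence of the normal points *)

Section Assembly.
Context {R : realType}.

(** A set that contains all integers from [L] on has density 1. *)
Lemma density_zero_gap (S : set nat) : density_zero R S ->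
  forall L, exists2 j, (L <= j)%N & j \notin S.
Proof.
move=> dS L; apply: contrapT => nex.
have inS j : (L <= j)%N -> j \in S.
  by move=> Lj; apply/negPn/negP => jS; apply: nex; exists j.
have q0 : (0 : R) < 1 / 4 by lra.
have [N _ hN] := cvgr_le _ dS _ q0.
pose n := maxn N (L.*2).+1.
have := hN n (leq_maxl _ _).
have n0 : 0 < n%:R :> R by rewrite ltr0n leq_max orbT.
have Ln : (L.*2 < n)%N by rewrite leq_max leqnn orbT.
have cnt : (n - L <= count_in S 1 n)%N.
  rewrite /count_in -sum1_count big_mkcond (big_cat_nat (n := L.+1))//=; last first.
    by rewrite -addnn in Ln; lia.
  apply: leq_trans (leq_addl _ _).
  rewrite -subSS -[leqLHS]muln1 -sum_nat_const_nat.
  rewrite big_nat_cond [X in (_ <= X)%N]big_nat_cond; apply: leq_sum => j /andP[/andP[Lj _] _].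
  by rewrite inS// ltnW.
rewrite ler_pdivrMr// => h.
have : (n - L)%:R <= (count_in S 1 n)%:R :> R by rewrite ler_nat.
rewrite natrB; last by rewrite -addnn in Ln; lia.
have : (L.*2)%:R <= n%:R :> R by rewrite ler_nat ltnW.
rewrite -mul2n natrM.
by lra.
Qed.

Lemma sparse_unbounded (S : set nat) (rho : R) (n : nat) : sparsity_exponent S rho ->
  exists L, (n <= count (fun k => k \in S) (iota 0 L))%N.
Proof.
move=> Srho.
have [K _ hK] := sparse_window S rho Srho.
pose k := maxn K (Num.truncn (expR n%:R : R)).+1.
have := hK k (leq_maxl _ _) 0%N (powR_ge0 _ _); rewrite add0n /count_in => h.
exists k.+1; rewrite -(ler_nat R) -[iota _ _]/(index_iota 0 k.+1).
apply: le_trans h.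
have nk : n%:R <= ln (k%:R : R).
  rewrite -[leLHS]expRK ler_ln ?posrE ?expR_gt0//.
    by apply: le_trans (ltW (truncnS_gt _)) _; rewrite ler_nat leq_maxr.
  by rewrite ltr0n leq_max orbT.
have : 0 <= (n%:R : R) by [].
by lra.
Qed.

(** An indicator function, written as a product so that independence of the bits
    gives its average. *)
Definition agree (P : pred nat) (v : nat -> bool) (L : nat) (w : nat -> bool) : R :=
  \prod_(k < L) (~~ P k || (w k == v k))%:R.

Lemma agree_ge0 P v L w : 0 <= agree P v L w.
Proof. exact: prodr_ge0. Qed.

Lemma avg_agree P v L : avg L (agree P v L) = 2^-1 ^+ count P (iota 0 L).
Proof.
rewrite /agree (avg_prod L (fun k x => (~~ P k || (x == v k))%:R)).
transitivity (\prod_(0 <= k < L | P k) (2^-1 : R)).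
  rewrite big_mkord [RHS]big_mkcond; apply: eq_bigr => k _.
  by case: (P k) => /=; [case: (v k) => /=; lra|lra].
by rewrite big_const_seq iter_mulr_1 /index_iota subn0.
Qed.

(** There are countably many conditions, each of which is a sequence of functions with
    summable averages: the scale energies for the pairs [(b, h)], and for each [i] the
    indicator functions of agreement with [v i] on ever longer initial segments
    of [S]. If [w] agreed with [v i] on the whole of [S], the latter would be
    constantly 1 instead of tending to 0. *)
Lemma generic_bits (S : set nat) (rho : R) (v : nat -> nat -> bool) :
  sparsity_exponent S rho ->
  exists w,
    (forall b h, (1 < b)%N -> odd b -> (0 < h)%N ->
      scale_energy (fun n => n \in S) b h k (precision b h k) w @[k --> \oo] --> (0 : R)) /\
    (forall i, exists2 k, k \in S & w k != v i k).
Proof.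
move=> Srho; pose P : pred nat := fun n => n \in S.
(* The first [B k] positions contain at least [2 * k.+1] elements of [S], so that
   agreement on them has probability at most [4 ^- k.+1 <= k.+1 ^- 2]. *)
have [B hB] : {B : nat -> nat & forall n, (2 * n.+1 <= count P (iota 0 (B n)))%N}.
  apply: (@choice _ _ (fun n B => (2 * n.+1 <= count P (iota 0 B))%N)) => n.
  exact: sparse_unbounded Srho.
pose good (bh : nat * nat) := [&& (1 < bh.1)%N, odd bh.1 & (0 < bh.2)%N].
pose L p k := match unpickle p : option (nat * nat + nat) with
  | Some (inl bh) => precision bh.1 bh.2 k
  | _ => B k end.
pose F p k w : R := match unpickle p : option (nat * nat + nat) with
  | Some (inl bh) => if good bh then scale_energy P bh.1 bh.2 k (precision bh.1 bh.2 k) w else 0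
  | Some (inr i) => agree P (v i) (B k) w
  | None => 0 end.
have [|||w hw] := @borel_cantelli R F L.
- move=> p k w; rewrite /F; case: unpickle => [[bh|i]|] //; last exact: agree_ge0.
  by case: ifP => // _; exact: scale_energy_ge0.
- move=> p k w w' e; rewrite /F; rewrite /L in e; move: e; case: unpickle => [[bh|i]|] // e.
    case: ifP => // _; apply: eq_bigr => m _; congr (_ / _).
    suff -> : truncated P (precision bh.1 bh.2 k) w = truncated P (precision bh.1 bh.2 k) w' :> R
      by [].
    by apply: eq_bigr => j _; rewrite e.
  by apply: eq_bigr => j _; rewrite e.
- move=> p; rewrite /F /L; case: unpickle => [[bh|i]|].
  + have [/and3P[b1 ob h0]|_] := boolP (good bh).
      near=> k; have : forall L, (2 * k < L)%N ->
          avg L (scale_energy P bh.1 bh.2 k L) <= k.+1%:R ^- 2 :> R.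
        by near: k; exact: (avg_scale_energy_le S rho).
      by apply; exact: precision_gt.
    by apply: nearW => k; rewrite avg0 invr_ge0 exprn_ge0.
  + apply: nearW => k; rewrite avg_agree.
    apply: (@le_trans _ _ (2^-1 ^+ (2 * k.+1))).
      by apply: ler_wiXn2l => //; rewrite ?invr_ge0// invf_le1// ler1n.
    rewrite mulnC exprM !exprVn lef_pV2 ?posrE ?exprn_gt0//.
    rewrite lerXn2r ?nnegrE ?exprn_ge0// -natrX ler_nat.
    by rewrite ltnW// ltn_expl.
  + by apply: nearW => k; rewrite avg0 invr_ge0 exprn_ge0.
exists w; split=> [b h b1 ob h0|i].
  have := hw (pickle (inl (b, h) : nat * nat + nat)).
  by rewrite /F pickleK /good /= b1 ob h0.
apply: contrapT => nex.
have ag k : agree P (v i) (B k) w = 1.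
  rewrite /agree big1// => j _; have [jS|jS] := boolP (P j) => //=.
  by case: eqP => //= /eqP ne; case: nex; exists j.
have := hw (pickle (inr i : nat * nat + nat)); rewrite /F pickleK.
under eq_fun do rewrite ag.
move=> /cvg_lim; rewrite lim_cst// => /(_ (@Rhausdorff R)) /eqP.
by rewrite oner_eq0.
Unshelve. all: by end_near.
Qed.

End Assembly.

Theorem theorem1 (R : realType) (S : set nat)
    (S_pos : forall n : nat, S n -> (0 < n)%N) (S_sparse : sparse R S) :
  ~ countable [set x : R | sparse_cantor S x /\
      forall b : nat, (2 <= b)%N -> odd b -> normal_in_base b x].
Proof.
set A := [set x : R | _] => Acount.
have [Sdens [rho Srho]] := S_sparse.
pose P : pred nat := fun n => n \in S.
have Pgap L : exists2 j, (L <= j)%N & ~~ P j by exact: (density_zero_gap S Sdens).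
have P0 : ~~ P 0 by apply/negP; rewrite /P inE => /S_pos.
have seriesE (w : nat -> bool) : series (fun k : nat => \1_S k * (w k)%:R * 2 ^- k : R) =
    (fun n => truncated P n w).
  apply/funext => n; rewrite seriesEord; apply: eq_bigr => k _.
  by rewrite indicE mulrAC mulrC.
have [g ginj] : exists g : R -> nat, {in A &, injective g}.
  by move/pcard_injP : Acount => [g]; exists g.
(* [v i] are bits of the point of [A] numbered [i], if there is one. *)
have [v hv] : {v : nat -> nat -> bool & forall i x, A x -> g x = i ->
    x = cantor_point P (v i)}.
  apply: (@choice _ _ (fun i v => forall x, A x -> g x = i -> x = cantor_point P v)) => i.
  have [[x [Ax gx]]|nx] := pselect (exists x, A x /\ g x = i); last first.
    by exists (fun=> true) => x Ax gx; case: nx; exists x.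
  have [[_ [v vx]] _] := Ax; exists v => y Ay gy.
  have -> : y = x by apply: ginj; rewrite ?inE// gx.
  rewrite seriesE in vx.
  apply: (cvg_unique _ vx (truncated_cvg P Pgap v)).
  exact: norm_hausdorff.
have [w [wE wv]] := generic_bits S rho v Srho.
pose x : R := cantor_point P w.
have Ax : A x.
  split.
    split; first exact: cantor_point_itv.
    by exists w; rewrite seriesE; exact: truncated_cvg.
  move=> b b2 ob k k0; apply: weyl_simply_normal.
    by rewrite -(exp1n k) ltn_exp2r.
  apply: weyl_null_point => //; first by rewrite -(exp1n k) ltn_exp2r.
  by move=> h h0; apply: wE => //; rewrite ?oddX ?ob ?orbT// -(exp1n k) ltn_exp2r.
have [k kS wk] := wv (g x).
have := cantor_point_inj P Pgap w (v (g x)) k kS wk (R := R).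
by rewrite -(hv (g x) x Ax erefl) eqxx.
Qed.
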